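(* Fix an integer $n\ge 3$. There is a constant $C=C(n)>0$ depending only on $n$ such that for any $\epsilon>2/n$ and all $H\ge 1$, $$\frac{1}{N(H)}\sum_{a\in Q(H)}\ \max_{c\in\mathbb{Q}^n}\frac{\mathrm{Gap}(c,a)}{\|a\|_\infty^{\epsilon}\,\|c\|_1}\le C .$$
   Context: For $H\ge 1$, $Q(H)$ is the set of $a=(a_1,\dots,a_n)^T\in\mathbb{Z}^n$ with all $a_i\neq0$, $\gcd(a_1,\dots,a_n)=1$ and $\|a\|_\infty\le H$; $N(H)$ is the cardinality of $Q(H)$. For $a\in\mathbb{Z}^n$, $b\in\mathbb{Z}$ let $P(a,b)=\{x\in\mathbb{R}^n_{\ge 0}: a^Tx=b\}$. For $c\in\mathbb{Q}^n$ let $IP(c,a,b)$ be the optimal value of the integer knapsack problem $\min\{c^Tx: x\in P(a,b)\cap\mathbb{Z}^n\}$ and $LP(c,a,b)$ the optimal value of its relaxation $\min\{c^Tx: x\in P(a,b)\}$. Set $IG(c,a,b)=IP(c,a,b)-LP(c,a,b)$ and $\mathrm{Gap}(c,a)=\max_b IG(c,a,b)$, where $b$ ranges over all integers such that the integer knapsack problem is feasible and bounded. The maximum over $c\in\mathbb{Q}^n$ is taken (as a supremum) over nonzero $c$ for which such $b$ exist. *)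

(* Defs.v *)
From HB Require Import structures.
From mathcomp Require Import all_boot all_order all_algebra.
From mathcomp Require Import finmap.
From mathcomp Require Import all_classical all_reals all_analysis.
Set Implicit Arguments.
Unset Strict Implicit.
Unset Printing Implicit Defensive.
Import Order.TTheory GRing.Theory Num.Theory.
Local Open Scope classical_set_scope.
Local Open Scope ring_scope.

Definition normoo (n : nat) (a : 'cV[int]_n) : nat := (\max_(i < n) `|a i ord0|)%N.

Definition norm1 (n : nat) (c : 'cV[rat]_n) : rat := \sum_(i < n) `|c i 0|.

Definition dot (R : realType) (n : nat) (u v : 'cV[R]_n) : R := (u^T *m v) 0 0.

Definition Q (R : realType) (n : nat) (H : R) : set 'cV[int]_n :=
  [set a : 'cV[int]_n | [/\ forall i, a i ord0 != 0,
               \big[gcdn/0%N]_(i < n) `|a i ord0|%N = 1%N &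
               (normoo a)%:R <= H]].

Arguments Q {R} n H.

(* [fset_set] and the finitely supported sum over [Q n H] return a default
   value on infinite sets; this rules that case out. *)
Lemma finite_Q (R : realType) (n : nat) (H : R) : finite_set (Q n H).
Proof.
pose K := Num.truncn H.
pose f (s : 'cV['I_(K + K).+1]_n) : 'cV[int]_n :=
  map_mx (fun j : 'I_(K + K).+1 => (j : nat)%:Z - K%:Z) s.
apply: (@sub_finite_set _ _ (f @` setT)); last exact/finite_image/finite_finset.
move=> a [_ _ aH].
have aK : (normoo a <= K)%N by rewrite truncn_ge_nat // (le_trans _ aH).
exists (\col_i inord `|(a i ord0 + K%:Z)%R|%N) => //.
apply/colP => i; rewrite !mxE.
have /andP[Ka aK'] : - K%:Z <= a i ord0 <= K%:Z.
  by rewrite -ler_norml -abszE lez_nat (leq_trans _ aK)// leq_bigmax.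
have aK0 : 0 <= a i ord0 + K%:Z by rewrite -lerBlDr sub0r.
rewrite (ord1 _) inordK; first by rewrite gez0_abs// addrK.
by rewrite ltnS -lez_nat gez0_abs// PoszD lerD2r.
Qed.

Definition N (R : realType) (n : nat) (H : R) : nat := #|` fset_set (Q n H)|%fset.

Definition P (R : realType) (n : nat) (a : 'cV[int]_n) (b : int) : set 'cV[R]_n :=
  [set x : 'cV[R]_n | (forall i, 0 <= x i 0) /\ dot (map_mx intr a) x = b%:~R].
Arguments P R {n} a b.

Definition IPvalues (R : realType) (n : nat) (c : 'cV[rat]_n) (a : 'cV[int]_n)
    (b : int) : set R :=
  [set dot (map_mx ratr c) x | x in
     P R a b `&` [set x : 'cV[R]_n | x \is a mxOver Num.int]].
Arguments IPvalues R {n} c a b.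

Definition LPvalues (R : realType) (n : nat) (c : 'cV[rat]_n) (a : 'cV[int]_n)
    (b : int) : set R :=
  [set dot (map_mx ratr c) x | x in P R a b].
Arguments LPvalues R {n} c a b.

Definition IP (R : realType) (n : nat) (c : 'cV[rat]_n) (a : 'cV[int]_n)
    (b : int) : \bar R :=
  ereal_inf [set v%:E | v in IPvalues R c a b].
Arguments IP R {n} c a b.

Definition LP (R : realType) (n : nat) (c : 'cV[rat]_n) (a : 'cV[int]_n)
    (b : int) : \bar R :=
  ereal_inf [set v%:E | v in LPvalues R c a b].
Arguments LP R {n} c a b.

Definition IG (R : realType) (n : nat) (c : 'cV[rat]_n) (a : 'cV[int]_n)
    (b : int) : \bar R :=
  (IP R c a b - LP R c a b)%E.
Arguments IG R {n} c a b.

(* [has_inf] says nonempty and bounded below, i.e. the integer problem is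
   feasible and bounded. *)
Definition admissible_rhs (R : realType) (n : nat) (c : 'cV[rat]_n)
    (a : 'cV[int]_n) : set int :=
  [set b : int | has_inf (IPvalues R c a b)].
Arguments admissible_rhs R {n} c a.

Definition Gap (R : realType) (n : nat) (c : 'cV[rat]_n) (a : 'cV[int]_n) : \bar R :=
  ereal_sup [set IG R c a b | b in admissible_rhs R c a].
Arguments Gap R {n} c a.

(* Optimal values and gaps live in the extended reals: an unbounded infimum or
   supremum is infinite instead of getting a default real value. For c = 0 the
   quotient would be meaningless, hence [c != 0]. *)
Definition max_relative_gap (R : realType) (n : nat) (eps : R) (a : 'cV[int]_n)
    : \bar R :=
  ereal_sup [set (Gap R c a * (((normoo a)%:R `^ eps * ratr (norm1 c))^-1)%:E)%E
            | c in [set c : 'cV[rat]_n | c != 0 /\ admissible_rhs R c a !=set0]].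
Arguments max_relative_gap {R n} eps a.

(* Main.v *)
(** For a fixed [a], let [j] be the optimal basis of the relaxation. Reducing
   modulo [a j] turns the integrality gap into a covering question: how large
   must a box be for the sums [\sum_(i != j) a i * x i] to meet every residue
   class modulo [a j]? If side [D] suffices for all [j], the gap is at most a
   constant times [D * |a|_oo / min_i |a i| * |c|_1].

   A box of side [r] gives a symmetric generating set of the cyclic group of
   order [|a j|]; the diameter of its Cayley graph is at most three times the
   order divided by the size of the set, and by Cauchy-Schwarz this quotient is
   controlled by the number of collisions between points of the box. That bound
   is linear in the number of collisions, so its mean over [a] can be computed
   by exchanging sums: two points [x], [x'] collide when [a j] divides
   [w = \sum_(i != j) a i * (x i - x' i)], and [w] has at most [w ^ o(1)]
   divisors. Taking [r] about [K ^ (1 / (n - 1))] bounds the sum of the gaps over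
   [|a|_oo <= K] by [K ^ (n + 1 / (n - 1) + o(1))], hence by [K ^ (n + 2 / n)]
   because [1 / (n - 1) < 2 / n]; the factor [|a|_oo ^ - eps] is then
   restored by dyadic decomposition. *)
Require Import Defs.
From mathcomp Require Import all_boot all_order all_algebra finmap.
From mathcomp Require Import all_classical all_reals all_analysis.
From mathcomp Require Import zify ring lra.
Import Order.TTheory GRing.Theory Num.Theory.
Local Open Scope classical_set_scope.
Local Open Scope ring_scope.

(** * Ball growth in Cayley graphs, and collisions *)

(* [B k] is the ball of radius [k] around [0] in a Cayley graph: the translates
   of [B 1] to points at distance 0, 3, 6, ... from [0] are disjoint. *)
Lemma ball_cover (A : finZmodType) (B : nat -> {set A}) :
    (forall k, 0 \in B k) ->
    (forall k l x y, x \in B k -> y \in B l -> x + y \in B (k + l)%N) ->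
    (forall k x, x \in B k -> - x \in B k) ->
    (forall k x, x \in B k.+1 -> exists2 y, y \in B k & x - y \in B 1%N) ->
    (forall x, exists k, x \in B k) ->
  forall x, x \in B (3 * (#|A| %/ #|B 1%N|))%N.
Proof.
move=> B0 BD BN BS Bex.
have BW k l x : (k <= l)%N -> x \in B k -> x \in B l.
  by move=> /subnKC <- xk; rewrite -[x]addr0 BD.
have grow i : (forall x, x \in B (3 * i)%N) \/
    (i.+1 * #|B 1%N| <= #|B (3 * i).+1|)%N.
  elim: i => [|i [IH|IH]]; first by right; rewrite mul1n muln0.
    by left=> x; apply: BW (IH x); rewrite leq_mul2l leqnSn orbT.
  (* If radius [3 * i + 3] adds no point, the balls have stopped growing. Otherwise a new point [h]
     gives a translate of [B 1] that misses [B (3 * i).+1] and lies in [B (3 * i.+1).+1]. *)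
  have [stable|] := pselect (forall x, x \in B (3 * i).+3 -> x \in B (3 * i).+2).
    left=> x; have [k xk] := Bex x.
    suff /(_ (k + 3 * i)%N x) : forall m y, y \in B (m + (3 * i).+2)%N -> y \in B (3 * i).+2.
      by rewrite mulnS => h; apply: BW (h (BW k _ x _ xk)); rewrite ?add3n//; lia.
    elim=> // m IHm y; rewrite addSn => /BS[z /IHm z2 yz].
    by apply: stable; rewrite -(subrK z y) addrC -addn1 BD.
  move=> /existsNP[h /not_implyP[h3 /negP h2]]; right.
  pose T : {set A} := (fun s => h + s) @: B 1%N.
  have cT : #|T| = #|B 1%N| by apply: card_imset => x y /= /addrI.
  have dT : disjoint (mem T) (mem (B (3 * i).+1)).
    apply/pred0P => y /=; apply/negbTE/negP => /andP[/imsetP[s s1 ->] /= hs].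
    by move: h2; rewrite -(addrK s h) -[(3 * i).+2]addn1 BD// BN.
  have sT : T :|: B (3 * i).+1 \subset B (3 * i.+1).+1.
    apply/fintype.subsetP => y /finset.setUP[/imsetP[s s1 ->]/=|yB].
      by rewrite mulnS -addn1 BD.
    by apply: BW yB; lia.
  have := subset_leq_card sT; rewrite cardsU (disjoint_setI0 dT) cards0 subn0 cT.
  by apply: leq_trans; rewrite mulSn leq_add2l.
(* For this [i] growth is impossible: [(i + 1) * #|B 1|] already exceeds [#|A|]. *)
have [//|big] := grow (#|A| %/ #|B 1%N|)%N.
have := leq_trans big (max_card _).
rewrite leqNgt ltn_ceil// card_gt0; apply/set0Pn; exists 0; exact: B0.
Qed.

(** Cauchy-Schwarz for the fibre sizes [r y]: they sum to [#|X|], and their squares sum to the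
    number of collisions. *)
Lemma card_sqr_le_collisions (X Y : finType) (f : X -> Y) (D : {set Y}) :
    (forall x, f x \in D) ->
  (#|X| ^ 2 <= #|D| * #|[pred p : X * X | f p.1 == f p.2]|)%N.
Proof.
move=> fD; pose r y := #|[pred x | f x == y]|.
have cX : #|X| = (\sum_(y in D) r y)%N.
  rewrite -sum1_card (partition_big f (mem D)) => [|x _]; last exact: fD.
  by apply: eq_bigr => y _; rewrite /r -sum1_card; apply: eq_bigl => x.
have -> : #|[pred p : X * X | f p.1 == f p.2]| = (\sum_(y in D) r y ^ 2)%N.
  rewrite -sum1_card (partition_big (fun p => f p.1) (mem D)) => [|p _]; last exact: fD.
  apply: eq_bigr => y _; rewrite sum1_card -mulnn /r -cardX; apply: eq_card => -[x x'].
  change ((f x == f x') && (f x == y) = (f x == y) && (f x' == y)).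
  by rewrite andbC; case: (f x =P y) => //= ->; rewrite eq_sym.
rewrite cX -mulnn big_distrlr/=.
rewrite -(leq_pmul2l (isT : 0 < 2)%N) big_distrr/=.
have -> : (2 * (#|D| * \sum_(y in D) r y ^ 2) =
   \sum_(y in D) \sum_(z in D) (r y ^ 2 + r z ^ 2))%N.
  transitivity (\sum_(y in D) (#|D| * r y ^ 2 + \sum_(z in D) r z ^ 2))%N.
    by rewrite big_split/= sum_nat_const -big_distrr/=; lia.
  by apply: eq_bigr => y _; rewrite big_split/= sum_nat_const.
apply: leq_sum => y _; rewrite big_distrr/=; apply: leq_sum => z _.
exact: (nat_Cauchy _ _).1.
Qed.

(** * The divisor bound *)

Lemma size_divisors_pfactor (p e u : nat) : prime p -> ~~ (p %| u)%N ->
  (size (divisors (p ^ e * u)) <= e.+1 * size (divisors u))%N.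
Proof.
move=> pp pu; have u0 : (0 < u)%N by case: u pu => //; rewrite dvdn0.
have w0 : (0 < p ^ e * u)%N by rewrite muln_gt0 expn_gt0 prime_gt0.
have -> : (e.+1 * size (divisors u) =
    size [seq (p ^ i * d)%N | i <- iota 0 e.+1, d <- divisors u])%N.
  by rewrite size_allpairs size_iota.
apply: uniq_leq_size (divisors_uniq _) _ => d; rewrite -dvdn_divisors// => dw.
have d0 : (0 < d)%N := dvdn_gt0 w0 dw.
apply/allpairsP; exists (logn p d, d`_p^')%N => /=; split.
- rewrite -[_ :: _]/(iota 0 e.+1) mem_iota ltnS; have := dvdn_leq_log p w0 dw.
  rewrite lognM ?expn_gt0 ?(prime_gt0 pp)// pfactorK// (_ : logn p u = 0%N) ?addn0//.
  by apply/eqP; rewrite -leqn0 leqNgt logn_gt0 mem_primes pp u0.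
- rewrite -dvdn_divisors// -(@Gauss_dvdr _ (p ^ e)%N).
    exact: dvdn_trans (dvdn_part _ _) dw.
  by rewrite coprime_sym (@pnat_coprime p) ?part_pnat// pnatX pnat_id.
- by rewrite -p_part partnC.
Qed.

(** A prime power [p ^ e] contributes a factor [e + 1] on the left and [p ^ (e s)] on the right. If
    [p >= 2 ^ (1 / s)], then [e + 1 <= 2 ^ e <= p ^ (e s)]; each of the finitely many smaller primes
    costs a constant [c]. *)
Lemma divisor_bound (R : realType) (s : R) : 0 < s -> exists2 C : R, 1 <= C &
  forall w, (0 < w)%N -> (size (divisors w))%:R <= C * w%:R `^ s.
Proof.
move=> s0; pose l : R := s * ln 2.
have l0 : 0 < l by rewrite mulr_gt0// ln_gt0// ltr1n.
(* Chosen so that [e + 1 <= c (1 + e l) <= c 2 ^ (e s)] for every [e]. *)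
pose c : R := 1 + l^-1.
have c1 : 1 <= c by rewrite lerDl invr_ge0 ltW.
pose P0 := (Num.truncn ((2:R) `^ s^-1)).+1.
have P0s (p : nat) : (P0 <= p)%N -> 2 <= (p%:R : R) `^ s.
  move=> Pp; have -> : 2 = (2 `^ s^-1) `^ s :> R.
    by rewrite -powRrM mulVf ?lt0r_neq0// powRr1.
  rewrite ge0_ler_powR ?nnegrE ?powR_ge0 ?(ltW s0)// ltW//.
  by rewrite (lt_le_trans (truncnS_gt _))// ler_nat.
have powX (p e : nat) : ((p ^ e)%:R : R) `^ s = (p%:R `^ s) ^+ e.
  by rewrite natrX -powR_mulrn// -powRrM mulrC powRrM powR_mulrn ?powR_ge0.
(* Induction on a strict bound [P] for the prime factors. The exponent [minn P P0] stops growing at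
   [P0], so large primes are free. *)
suff smooth P w : (0 < w)%N -> (forall p, prime p -> (p %| w)%N -> (p < P)%N) ->
    (size (divisors w))%:R <= c ^+ minn P P0 * w%:R `^ s.
  exists (c ^+ P0) => [|w w0]; first exact: exprn_ege1.
  have wP p : prime p -> (p %| w)%N -> (p < w.+1)%N by move=> _ /dvdn_leq; exact.
  apply: (le_trans (smooth _ _ w0 wP)); rewrite ler_wpM2r ?powR_ge0// ler_weXn2l//.
  exact: geq_minr.
elim: P w => [|P IH] w w0 wP.
  have -> : w = 1%N.
    case: w w0 wP => [|[|w]] // _ wP.
    by have := wP _ (pdiv_prime (isT : 1 < w.+2)%N) (pdiv_dvd w.+2).
  by rewrite powR1 mulr1 exprn_ege1.
have [/andP[pp Pw]|nP] := boolP (prime P && (P %| w)%N); last first.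
  have /(IH _ w0) : forall p, prime p -> (p %| w)%N -> (p < P)%N.
    move=> p pp pw; have := wP _ pp pw; rewrite ltnS leq_eqVlt => /predU1P[pP|//].
    by move: nP; rewrite -pP pp pw.
  move=> /le_trans; apply; rewrite ler_wpM2r ?powR_ge0// ler_weXn2l//; lia.
have [u Pu defw] := pfactor_coprime pp w0; set e := logn P w in defw.
have {}Pu : ~~ (P %| u)%N by rewrite -prime_coprime.
have u0 : (0 < u)%N by case: (u) Pu => //; rewrite dvdn0.
have uP p : prime p -> (p %| u)%N -> (p < P)%N.
  move=> qp qu; have := wP p qp; rewrite defw dvdn_mulr// => /(_ isT).
  by rewrite ltnS leq_eqVlt => /predU1P[pP|//]; move: Pu; rewrite -pP qu.
have step : (size (divisors w))%:R <= e.+1%:R * (size (divisors u))%:R :> R.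
  by rewrite -natrM ler_nat defw mulnC size_divisors_pfactor.
apply: (le_trans step).
have wE : w%:R `^ s = (P%:R `^ s) ^+ e * u%:R `^ s :> R.
  by rewrite -powX -powRM// -natrM mulnC -defw.
rewrite wE mulrCA.
have [Pbig|Psmall] := leqP P0 P.
  apply: ler_pM => //.
    rewrite (le_trans _ (lerXn2r e _ _ (P0s _ Pbig)))// ?nnegrE ?powR_ge0//.
    by rewrite -natrX ler_nat ltn_expl.
  apply: (le_trans (IH u u0 uP)); rewrite ler_wpM2r ?powR_ge0// ler_weXn2l//; lia.
have -> : c ^+ minn P.+1 P0 = c * c ^+ minn P P0 by rewrite -exprS; congr (_ ^+ _); lia.
rewrite -[c * _ * _]mulrA mulrCA [X in _ <= X]mulrA.
apply: ler_pM => //; last exact: IH.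
have P2 : 2 `^ s <= P%:R `^ s :> R.
  by rewrite ge0_ler_powR ?nnegrE ?(ltW s0)// ler_nat prime_gt1.
have e2 : 1 + e%:R * l <= (2 `^ s) ^+ e :> R.
  rewrite /powR pnatr_eq0/= -expRM_natl (le_trans (expR_ge1Dx _))// lerD2l /l.
apply: (@le_trans _ _ (c * (1 + e%:R * l))); last first.
  rewrite ler_wpM2l ?(le_trans _ c1)// (le_trans e2)// lerXn2r ?nnegrE ?powR_ge0//.
have -> : c * (1 + e%:R * l) = 1 + e%:R * l + l^-1 + e%:R * (l^-1 * l).
  by rewrite /c; ring.
rewrite mulVf ?lt0r_neq0// mulr1 -natr1.
have : 0 <= e%:R * l by rewrite mulr_ge0// ltW.
have : 0 < l^-1 by rewrite invr_gt0.
lra.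
Qed.

(** * Covering residue classes by boxes *)

Definition covers {n} (a : 'I_n -> int) (j : 'I_n) (D : nat) : Prop :=
  forall v : int, exists2 x : 'I_n -> nat, (forall i, (x i <= D)%N) &
    (a j %| v - \sum_(i | i != j) a i * (x i)%:Z)%Z.

(* The [j]-th coordinates of the two points play no role; they only multiply all
   counts by a common factor, which avoids indexing by [{i | i != j}]. *)
Definition collides {n r} (a : 'I_n -> int) (j : 'I_n)
    (p : {ffun 'I_n -> 'I_r.+1} * {ffun 'I_n -> 'I_r.+1}) : bool :=
  (a j %| \sum_(i | i != j) a i * ((p.1 i)%:Z - (p.2 i)%:Z))%Z.

(** This will make the Cayley graph connected: every residue is a combination of the
    coefficients. *)
Lemma bezout_bigop {n} (a : 'I_n -> int) :
  \big[gcdn/0%N]_(i < n) `|a i|%N = 1%N -> exists u : 'I_n -> int, \sum_i a i * u i = 1.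
Proof.
suff : exists u : 'I_n -> int, \sum_i a i * u i = (\big[gcdn/0%N]_(i < n) `|a i|%N)%:Z.
  by move=> [u uE] g1; exists u; rewrite uE g1.
apply: (big_ind (fun d : nat => exists u : 'I_n -> int, \sum_i a i * u i = d%:Z)).
- by exists (fun=> 0); rewrite big1// => i _; rewrite mulr0.
- move=> d e [u uE] [v vE]; have [s [t stE]] := Bezoutz d%:Z e%:Z.
  exists (fun i => u i * s + v i * t).
  under eq_bigr do rewrite mulrDr !mulrA.
  by rewrite big_split/= -!mulr_suml uE vE mulrC [e%:Z * t]mulrC stE.
- move=> i _; exists (fun k => if k == i then sgz (a i) else 0).
  rewrite (bigD1 i)//= eqxx big1 => [|k /negbTE ->]; last by rewrite mulr0.
  by rewrite addr0 abszEsg mulrC.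
Qed.

(** In the cyclic group of order [|a j|], let [B k] be the classes of [L z] with all [|z i| <= k r].
    [ball_cover] bounds the diameter by [3 |a j| / #|B 1|], and Cauchy-Schwarz on the box of side
    [r] bounds [#|B 1|] below through the collisions. *)
Lemma covers_collisions {n} (a : 'I_n -> int) (j : 'I_n) (r : nat) :
    a j != 0 -> \big[gcdn/0%N]_(i < n) `|a i|%N = 1%N -> (0 < r)%N ->
  exists D, [/\ covers a j D, (0 < D)%N &
    (D * (r.+1 ^ n) ^ 2 <= 6 * r * `|a j| * #|[pred p | @collides n r a j p]|)%N].
Proof.
move=> aj0 g1 r0; pose q := `|a j|%N.-1.
have qE : q.+1 = `|a j|%N by rewrite prednK// absz_gt0.
pose phi (z : int) : 'I_q.+1 := (inZp 1 : 'I_q.+1) *~ z.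
have phiB x y : phi (x - y) = phi x - phi y by exact: mulrzBr.
have phiD x y : phi (x + y) = phi x + phi y by exact: mulrzDr.
have phi_nat (m : nat) : phi m%:Z = inZp m.
  by rewrite /phi -pmulrn Zp_mulrn; apply/val_inj; rewrite /= modnMml mul1n.
have phi0 z : (phi z == 0) = (a j %| z)%Z.
  have nat0 (m : nat) : (phi m%:Z == 0) = (q.+1 %| m)%N by rewrite phi_nat -val_eqE.
  rewrite dvdzE -qE -nat0; case: z => m //=.
  by rewrite NegzE -[- _]sub0r phiB {1}/phi mulr0z sub0r oppr_eq0.
have phij z : phi (a j * z) = 0 by apply/eqP; rewrite phi0 dvdz_mulr.
pose L (z : 'I_n -> int) := \sum_(i | i != j) a i * z i.
pose B k : {set 'I_q.+1} := finset.finset (fun g => `[< exists2 z : 'I_n -> int,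
  (forall i, - (k * r)%N%:Z <= z i <= (k * r)%N%:Z) & g = phi (L z) >]).
have LD x y : L (fun i => x i + y i) = L x + L y.
  by rewrite /L -big_split/=; apply: eq_bigr => i _; rewrite mulrDr.
have LN x : L (fun i => - x i) = - L x.
  by rewrite /L -sumrN; apply: eq_bigr => i _; rewrite mulrN.
have inB k z : (forall i, - (k * r)%N%:Z <= z i <= (k * r)%N%:Z) -> phi (L z) \in B k.
  by move=> h; rewrite finset.in_set; apply/asboolP; exists z.
have BP k g : g \in B k -> exists2 z : 'I_n -> int,
  (forall i, - (k * r)%N%:Z <= z i <= (k * r)%N%:Z) & g = phi (L z).
  by rewrite finset.in_set => /asboolP.
have L0 : L (fun=> 0) = 0 by rewrite /L big1// => i _; rewrite mulr0.
have B0 k : 0 \in B k.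
  have -> : 0 = phi (L (fun=> 0)) by rewrite L0 /phi mulr0z.
  by apply: inB => i; lia.
have cover := @ball_cover 'I_q.+1 B B0 _ _ _ _.
pose k := (3 * (#|'I_q.+1| %/ #|B 1%N|))%N.
have kP g : g \in B k.
  apply: cover => {g}.
  - move=> k1 k2 _ _ /BP[x xk ->] /BP[y yk ->]; rewrite -phiD -LD; apply: inB => i.
    by have := xk i; have := yk i; rewrite mulnDl; lia.
  - move=> k1 _ /BP[x xk ->].
    have -> : - phi (L x) = phi (L (fun i => - x i)).
      by rewrite LN -[- L x]sub0r phiB {2}/phi mulr0z sub0r.
    by apply: inB => i; have := xk i; lia.
  - move=> k1 _ /BP[z zk ->]; have [m mE] : exists m, m = (k1 * r)%N%:Z by exists (k1 * r)%N%:Z.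
    (* Truncating [z] to [[-m, m]] leaves a remainder with entries in [[-r, r]]. *)
    pose w i := if z i < - m then - m else if m < z i then m else z i.
    exists (phi (L w)); first by apply: inB => i; rewrite /w -mE; do 2?case: ifP; lia.
    rewrite -phiB -LN -LD; apply: inB => i.
    by have := zk i; rewrite mul1n mulSn PoszD -mE /w; do 2?case: ifP; lia.
  (* Multiply the Bezout relation by [g]; its [j]-th term vanishes modulo [a j]. Since [r >= 1], the
     largest [|z i|] is a sufficient radius. *)
  - move=> g; have [u uE] := bezout_bigop a g1.
    pose z i := g%:Z * u i; exists (\max_i `|z i|)%N.
    have -> : g = phi (L z).
      rewrite -[g in LHS]valZpK -phi_nat -[in LHS](mulr1 (_%:Z)) -uE (bigD1 j)//=.
      rewrite mulrDr phiD mulrCA phij add0r mulr_sumr; congr phi.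
      by apply: eq_bigr => i _; rewrite mulrCA.
    apply: inB => i; have : (`|z i| <= (\max_i `|z i|) * r)%N.
      by rewrite (leq_trans (leq_bigmax (F := fun i => `|z i|%N) i))// leq_pmulr.
    by move: (_ * r)%N => m; lia.
have B1 : (0 < #|B 1%N|)%N by rewrite card_gt0; apply/set0Pn; exists 0.
(* Shifting [[-k r, k r]] by [k r] makes the coordinates natural numbers, which doubles the side of
   the box. *)
exists (2 * (k * r))%N; split.
- move=> v; have /BP[z zk zE] := kP (phi (v - L (fun=> (k * r)%N%:Z))).
  exists (fun i => `|(z i + (k * r)%N%:Z)%R|%N) => [i|]; first by have := zk i; lia.
  have -> : \sum_(i | i != j) a i * `|(z i + (k * r)%N%:Z)%R|%N%:Z = L z + L (fun=> (k * r)%N%:Z).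
    rewrite -LD; apply: eq_bigr => i _; congr (_ * _).
    by rewrite gez0_abs//; have := zk i; lia.
  by rewrite opprD addrA addrAC -phi0 phiB zE subrr.
- by rewrite !muln_gt0 r0 andbT /= divn_gt0// max_card.
- have coll := @card_sqr_le_collisions {ffun 'I_n -> 'I_r.+1} 'I_q.+1
    (fun x => phi (L (fun i => (x i)%:Z))) (B 1%N) _.
  have {}coll : ((r.+1 ^ n) ^ 2 <= #|B 1%N| * #|[pred p | @collides n r a j p]|)%N.
    have := coll _; rewrite card_ffun !card_ord => /(_ _)/leq_trans; apply.
      by move=> x; apply: inB => i; have := ltn_ord (x i); rewrite mul1n; lia.
    rewrite leq_mul2l; apply/orP; right; apply/eq_leq/eq_card => p.
    rewrite !inE /collides -phi0 -subr_eq0 -phiB -LN -LD; congr (phi _ == 0).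
  rewrite /k (card_ord q.+1) -qE.
  apply: (leq_trans (leq_mul (leqnn _) coll)).
  have := leq_divM q.+1 #|B 1%N|; set t := (_ %/ _)%N; set b := #|B 1%N|.
  set c := #|_|; move=> tb; rewrite (_ : _ * _ = 6 * r * c * (t * b))%N; last by lia.
  by rewrite (_ : (6 * r * q.+1 * c = 6 * r * c * q.+1)%N) ?leq_mul2l ?tb ?orbT//; lia.
Qed.

(** * From coverings to integrality gaps *)

(* If some [a k] is negative, a large multiple of [a j] worth of slack is bought by
   shifting the [k]-th coordinate of the box; otherwise either [b] exceeds the
   values of [a] on the box, or [b] is so small that every solution is short. *)
Lemma short_solution {n} (a : 'I_n -> int) (b : int) (x0 : 'I_n -> nat) (j : 'I_n) (D M : nat) :
    covers a j D -> (forall i, (`|a i| <= M)%N) -> 0 < a j -> 0 <= b ->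
    \sum_i a i * (x0 i)%:Z = b ->
  exists2 x : 'I_n -> nat, \sum_i a i * (x i)%:Z = b &
    (\sum_(i | i != j) `|a i| * x i <= (2 * n * D + 1) * M)%N.
Proof.
move=> cov aM aj b0 x0b.
pose S (w : 'I_n -> nat) := \sum_(i | i != j) a i * (w i)%:Z.
(* Coordinate [j] is free: it absorbs the nonnegative quotient [(b - S w) / a j]. *)
have complete w : (a j %| b - S w)%Z -> S w <= b ->
    (\sum_(i | i != j) `|a i| * w i <= (2 * n * D + 1) * M)%N ->
    exists2 x : 'I_n -> nat, \sum_i a i * (x i)%:Z = b &
      (\sum_(i | i != j) `|a i| * x i <= (2 * n * D + 1) * M)%N.
  move=> /dvdzP[t tE] Sb wB.
  have t0 : 0 <= t by move: Sb; rewrite -subr_ge0 tE pmulr_lge0.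
  exists (fun i => if i == j then `|t|%N else w i); last first.
    by under eq_bigr => i /negbTE -> do [].
  rewrite (bigD1 j)//= eqxx gez0_abs// mulrC -tE.
  by under eq_bigr => i /negbTE -> do []; rewrite -/(S w) subrK.
have box u : (forall i, (u i <= D)%N) -> (\sum_(i | i != j) `|a i| * u i <= n * (M * D))%N.
  move=> uD; apply: (@leq_trans (\sum_(i : 'I_n) M * D)%N); last by rewrite sum_nat_const card_ord.
  rewrite big_mkcond/=; apply: leq_sum => i _; case: ifP => // _.
  exact: leq_mul (aM i) (uD i).
have Sabs u : S u <= (\sum_(i | i != j) `|a i| * u i)%N%:Z.
  rewrite /S -[leRHS]/(Posz _) (big_morph Posz PoszD (erefl _)); apply: ler_sum => i _.
  by rewrite PoszM ler_wpM2r// abszE ler_norm.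
have [[k ak]|apos] := pselect (exists k, a k < 0).
  have kj : k != j by apply: contraL ak => /eqP ->; rewrite -leNgt ltW.
  (* The least choice with [|a k| L > n M D], so the shift outweighs any sum over the box while
     [|a k| L <= n M D + M]. Adding the box itself gives [(2 n D + 1) M]. *)
  pose L := ((n * (M * D)) %/ `|a k|).+1.
  have [u uD du] := cov (b - a k * L%:Z).
  have ak0 : (0 < `|a k|)%N by rewrite absz_gt0 ltr0_neq0.
  have SE : S (fun i => u i + (i == k) * L)%N = S u + a k * L%:Z.
    rewrite /S [in LHS](bigD1 k)//= [in RHS](bigD1 k)//= eqxx mul1n PoszD mulrDr.
    rewrite addrAC; congr (_ + _ + _); apply: eq_bigr => i /andP[_ /negbTE ->].
    by rewrite mul0n addn0.
  have NE : (\sum_(i | i != j) `|a i| * (u i + (i == k) * L) =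
      \sum_(i | i != j) `|a i| * u i + `|a k| * L)%N.
    rewrite [in LHS](bigD1 k)//= [in RHS](bigD1 k)//= eqxx mul1n mulnDr addnAC.
    by congr (_ + _ + _)%N; apply: eq_bigr => i /andP[_ /negbTE ->]; rewrite mul0n addn0.
  have := box u uD; have := Sabs u; set X := (\sum_(_ | _) _ * u _)%N in NE *.
  have := ltn_ceil (n * (M * D)) ak0; have := leq_divM (n * (M * D)) `|a k|.
  rewrite -/L; set p := (n * (M * D))%N => pL1 pL2 SX Xp.
  have LE : (`|a k| * L = p %/ `|a k| * `|a k| + `|a k|)%N by rewrite /L mulnC mulSn addnC.
  apply: (complete (fun i => u i + (i == k) * L)%N).
  - by rewrite SE opprD addrA addrAC.
  - have akL : a k * L%:Z = - (`|a k| * L)%N%:Z by rewrite PoszM ltz0_abs// mulNr opprK.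
    rewrite SE akL; move: pL2; rewrite mulnC; lia.
  - rewrite NE LE; have := aM k; rewrite mulnDl mul1n.
    have -> : (2 * n * D * M = p + p)%N by rewrite /p; lia.
    lia.
have [bbig|bsmall] := leP ((n * (M * D))%N%:Z) b.
  have [u uD du] := cov b; apply: (complete u) => //.
    by apply: le_trans bbig; apply: (le_trans (Sabs u)); rewrite lez_nat box.
  by apply: (leq_trans (box u uD)); lia.
exists x0 => //; apply: (@leq_trans `|b|%N); last by lia.
rewrite -lez_nat gez0_abs// -x0b [in leRHS](bigD1 j)//= (big_morph Posz PoszD (erefl _)).
apply: ler_wpDl; first by rewrite mulr_ge0// ltW.
apply: ler_sum => i _; rewrite PoszM gez0_abs//.
by rewrite leNgt; apply/negP => ai; apply: apos; exists i.
Qed.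

(** The index [j] minimizing [c i / a i] over positive [a i] is the optimal basis, and
    [y = c j / a j] is a dual solution; the last hypothesis gives its feasibility at negative
    coefficients. The gap is then the sum of reduced costs [c i - y a i] times [x i] over [i != j],
    for the short solution [x]. *)
Lemma knapsack_gap {R : realType} {n} (a : 'I_n -> int) (c : 'I_n -> R) (b : int)
    (x0 : 'I_n -> nat) (D M m : nat) :
    (forall j, covers a j D) -> (forall i, (m <= `|a i| <= M)%N) -> (0 < m)%N ->
    0 <= b -> (exists i, 0 < a i) -> \sum_i a i * (x0 i)%:Z = b ->
    (forall i k, 0 < a i -> a k < 0 -> 0 <= c k * (a i)%:~R - c i * (a k)%:~R) ->
  exists y (x : 'I_n -> nat), [/\ forall i, y * (a i)%:~R <= c i,
    \sum_i a i * (x i)%:Z = b &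
    \sum_i c i * (x i)%:R - y * b%:~R <=
      ((2 * n * D + 1) * M)%:R / m%:R * \sum_i `|c i|].
Proof.
move=> cov amM m0 b0 [i0 ai0] x0b dual.
have apos i : 0 < a i -> 0 < (a i)%:~R :> R by rewrite ltr0z.
case: (arg_minP (P := fun i => 0 < a i) (fun i => c i / (a i)%:~R) ai0) => j aj jmin.
pose y := c j / (a j)%:~R.
have yd i : y * (a i)%:~R <= c i.
  have [ai|ai|ai] := ltgtP (a i) 0.
  - have := dual j i aj ai; rewrite subr_ge0 /y mulrAC ler_pdivrMr ?apos//.
  - by rewrite -ler_pdivlMr ?apos//; exact: jmin.
  - by have := amM i; rewrite ai absz0 leqNgt m0.
have [x xb xB] := short_solution a b x0 j D M (cov j) (fun i => proj2 (andP (amM i))) aj b0 x0b.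
exists y, x; split => //.
have -> : \sum_i c i * (x i)%:R - y * b%:~R =
    \sum_(i | i != j) (c i - y * (a i)%:~R) * (x i)%:R.
  rewrite -xb rmorph_sum/= mulr_sumr -sumrB (bigD1 j)//= [X in X + _](_ : _ = 0) ?add0r.
    by apply: eq_bigr => i _; rewrite intrM mulrBl mulrA.
  by rewrite intrM mulrA /y divfK ?subrr// gt_eqF ?apos.
have m0R : 0 < m%:R :> R by rewrite ltr0n.
have absR i : `|(a i)%:~R| = `|a i|%N%:R :> R by rewrite -intr_norm -abszE pmulrn.
(* Both [|a i|] and [|a j|] are at least [m], so [|a i|] factors out and the weighted sum from
   [short_solution] appears. *)
have red i : i != j -> c i - y * (a i)%:~R <= `|a i|%N%:R * ((\sum_i `|c i|) / m%:R).
  move=> ij; have /andP[mi _] := amM i; have /andP[mj _] := amM j.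
  apply: (@le_trans _ _ (`|c i| + `|c j| / m%:R * `|a i|%N%:R)).
    apply: (le_trans (ler_norm _)); apply: (le_trans (ler_normB _ _)).
    rewrite lerD2l normrM absR /y normrM normfV absR ler_wpM2r//.
    by rewrite ler_wpM2l// lef_pV2 ?posrE ?ler_nat// ltr0n (leq_trans m0).
  apply: (@le_trans _ _ (`|a i|%N%:R * ((`|c i| + `|c j|) / m%:R))).
    rewrite mulrDl mulrDr [_ * (`|c j| / _)]mulrC lerD2r mulrA ler_pdivlMr//.
    by rewrite mulrC ler_wpM2r// ler_nat.
  rewrite ler_wpM2l// ler_wpM2r ?invr_ge0 ?(ltW m0R)//.
  by rewrite (bigD1 j)//= (bigD1 i)//= addrCA addrA lerDl sumr_ge0.
apply: (@le_trans _ _ (\sum_(i | i != j) `|a i|%N%:R * (x i)%:R * ((\sum_i `|c i|) / m%:R))).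
  apply: ler_sum => i ij; rewrite [leRHS]mulrAC; rewrite ler_wpM2r//; exact: red.
rewrite -mulr_suml mulrAC -mulrA ler_wpM2r ?divr_ge0 ?sumr_ge0//.
under eq_bigr do rewrite -natrM.
by rewrite -natr_sum ler_nat.
Qed.

Lemma coversN {n} (a : 'I_n -> int) (j : 'I_n) (D : nat) :
  covers a j D -> covers (fun i => - a i) j D.
Proof.
move=> cov v; have [x xD xd] := cov (- v); exists x => //.
suff -> : v - \sum_(i | i != j) - a i * (x i)%:Z =
    - (- v - \sum_(i | i != j) a i * (x i)%:Z) by rewrite dvdzE !abszN -dvdzE.
rewrite opprB opprK addrC -sumrN; congr (_ + _).
by apply: eq_bigr => i _; rewrite mulNr opprK.
Qed.

(** Negating [a], [b] and [y] preserves the problem, and feasibility ensures that one of the two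
    signs has [b >= 0] and a positive coefficient. *)
Lemma knapsack_gap_signed {R : realType} {n} (a : 'I_n.+1 -> int) (c : 'I_n.+1 -> R) (b : int)
    (x0 : 'I_n.+1 -> nat) (D M m : nat) :
    (forall j, covers a j D) -> (forall i, (m <= `|a i| <= M)%N) -> (0 < m)%N ->
    \sum_i a i * (x0 i)%:Z = b ->
    (forall i k, 0 < a i -> a k < 0 -> 0 <= c k * (a i)%:~R - c i * (a k)%:~R) ->
  exists y (x : 'I_n.+1 -> nat), [/\ forall i, y * (a i)%:~R <= c i,
    \sum_i a i * (x i)%:Z = b &
    \sum_i c i * (x i)%:R - y * b%:~R <=
      ((2 * n.+1 * D + 1) * M)%:R / m%:R * \sum_i `|c i|].
Proof.
move=> cov amM m0 x0b dual.
have [[b0 apos]|H] := pselect (0 <= b /\ exists i, 0 < a i).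
  exact: (knapsack_gap a c b x0 D M m).
have [y [x [yd xb xB]]] : exists y (x : 'I_n.+1 -> nat),
    [/\ forall i, y * (- a i)%:~R <= c i, \sum_i - a i * (x i)%:Z = - b &
    \sum_i c i * (x i)%:R - y * (- b)%:~R <=
      ((2 * n.+1 * D + 1) * M)%:R / m%:R * \sum_i `|c i|].
  apply: (knapsack_gap (fun i => - a i) c (- b) x0 D M m) => //.
  - by move=> j; exact: coversN.
  - by move=> i; rewrite abszN.
  - rewrite oppr_ge0 leNgt; apply/negP => b0; apply: H; split; first exact: ltW.
    apply: contrapT => nex; move: b0; rewrite -x0b ltNge => /negP; apply.
    rewrite -oppr_ge0 -sumrN; apply: sumr_ge0 => i _; rewrite -mulNr mulr_ge0// oppr_ge0.
    by rewrite leNgt; apply/negP => ai; apply: nex; exists i.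
  - apply: contrapT => nex; have apos i : 0 < a i.
      have /andP[mi _] := amM i; have ai0 : a i != 0.
        by rewrite -absz_gt0 (leq_trans m0).
      by rewrite lt_neqAle eq_sym ai0 leNgt; apply/negP => ai; apply: nex; exists i; rewrite oppr_gt0.
    apply: H; split; last by exists ord0.
    by rewrite -x0b sumr_ge0// => i _; rewrite mulr_ge0// ltW.
  - by rewrite -x0b -sumrN; apply: eq_bigr => i _; rewrite mulNr.
  - move=> i k; rewrite oppr_gt0 oppr_lt0 => ai ak; have := dual k i ak ai.
    by rewrite !rmorphN/= !mulrN opprK addrC.
exists (- y), x; split.
- by move=> i; have := yd i; rewrite rmorphN/= mulrN mulNr.
- by apply: oppr_inj; rewrite -xb -sumrN; apply: eq_bigr => i _; rewrite mulNr.
- by move: xB; rewrite rmorphN/= mulrN mulNr.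
Qed.

(** Boundedness of the integer problem supplies the dual condition: if it failed for [i] and [k],
    then adding multiples of [|a i| e_k + |a k| e_i] would keep the constraint and lower the
    objective without limit. The relaxation is bounded below by [y b] through weak duality. *)
Lemma IG_le {R : realType} {n} (a : 'cV[int]_n.+1) (c : 'cV[rat]_n.+1) (b : int) (D M m : nat) :
    (forall j, covers (fun i => a i ord0) j D) ->
    (forall i, (m <= `|a i ord0| <= M)%N) -> (0 < m)%N ->
    admissible_rhs R c a b ->
  (IG R c a b <= (((2 * n.+1 * D + 1) * M)%:R / m%:R * ratr (norm1 c))%:E)%E.
Proof.
move=> cov amM m0 [[v0 [xr [[xr0 xrb] xri] v0E]] [lb lbP]].
pose vec (x : 'I_n.+1 -> nat) : 'cV[R]_n.+1 := \col_i (x i)%:R.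
have dotc (x : 'I_n.+1 -> nat) : dot (map_mx ratr c) (vec x) = \sum_i ratr (c i 0) * (x i)%:R.
  by rewrite /dot mxE; apply: eq_bigr => i _; rewrite !mxE.
have dota (x : 'I_n.+1 -> nat) :
    dot (map_mx intr a) (vec x) = (\sum_i a i ord0 * (x i)%:Z)%:~R :> R.
  by rewrite /dot mxE rmorph_sum/=; apply: eq_bigr => i _; rewrite !mxE intrM.
have vecP (x : 'I_n.+1 -> nat) : \sum_i a i ord0 * (x i)%:Z = b ->
    IPvalues R c a b (\sum_i ratr (c i 0) * (x i)%:R).
  move=> xb; exists (vec x); rewrite ?dotc//; split; last first.
    by apply/mxOverP => i j; rewrite mxE.
  by split=> [i|]; rewrite ?mxE// dota xb.
pose x0 i := Num.truncn (xr i 0).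
have xrE : xr = vec x0.
  apply/colP => i; rewrite mxE /x0 truncnK// natrEint xr0 andbT.
  by move/mxOverP: xri; apply.
have x0b : \sum_i a i ord0 * (x0 i)%:Z = b.
  by apply: (@intr_inj R); rewrite -dota -xrE.
have dual i k : 0 < a i ord0 -> a k ord0 < 0 ->
    0 <= ratr (c k 0) * (a i ord0)%:~R - ratr (c i 0) * (a k ord0)%:~R :> R.
  move=> ai ak; set d : R := (X in 0 <= X); rewrite leNgt; apply/negP => d0.
  have ik : i != k by apply: contraTneq ai => ->; rewrite -leNgt ltW.
  (* Each multiple changes the objective by [d < 0]; this many push it from [v0] below [lb]. *)
  pose t := (Num.truncn ((v0 - lb) / - d)).+1.
  pose x l := (x0 l + t * ((l == k) * `|a i ord0| + (l == i) * `|a k ord0|))%N.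
  have sum2 (F : 'I_n.+1 -> R) : \sum_l F l * (x l)%:R = \sum_l F l * (x0 l)%:R
      + t%:R * (F k * (a i ord0)%:~R - F i * (a k ord0)%:~R).
    have delta (G : 'I_n.+1 -> R) l0 : \sum_l (l == l0)%:R * G l = G l0.
      by rewrite (bigD1 l0)//= eqxx mul1r big1 ?addr0// => l /negbTE ->; rewrite mul0r.
    rewrite -[F k * _](delta (fun l => F l * _)) -[F i * _](delta (fun l => F l * _)).
    rewrite -sumrB mulr_sumr -big_split/=; apply: eq_bigr => l _.
    rewrite /x natrD natrM natrD !natrM !pmulrn.
    by rewrite (gtz0_abs ai) (ltz0_abs ak) rmorphN/=; ring.
  have xb : \sum_l a l ord0 * (x l)%:Z = b.
    apply: (@intr_inj R); rewrite -x0b !rmorph_sum/=.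
    under eq_bigr do rewrite intrM; under [RHS]eq_bigr do rewrite intrM.
    by rewrite (sum2 (fun l => (a l ord0)%:~R)) [_ * (a i ord0)%:~R]mulrC subrr mulr0 addr0.
  have := lbP _ (vecP _ xb); rewrite (sum2 (fun l => ratr (c l 0))) -/d -dotc -xrE v0E.
  apply/negP; rewrite -ltNge -ltrBrDl -ltrN2 opprB -mulrN -ltr_pdivrMr ?oppr_gt0//.
  exact: truncnS_gt.
have [y [x [yd xb xB]]] := knapsack_gap_signed (fun i => a i ord0)
  (fun i => ratr (c i 0)) b x0 D M m cov amM m0 x0b dual.
have norm1E : ratr (norm1 c) = \sum_i `|ratr (c i 0)| :> R.
  by rewrite /norm1 rmorph_sum/=; apply: eq_bigr => i _; rewrite ratr_norm.
rewrite norm1E; apply: (@le_trans _ _ (\sum_i ratr (c i 0) * (x i)%:R - y * b%:~R)%:E).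
  rewrite EFinB; apply: leeB.
    by apply: ereal_inf_lbound; exists (\sum_i ratr (c i 0) * (x i)%:R) => //; exact: vecP.
  apply: le_ereal_inf_tmp => _ [_ [z [z0 zb] <-] <-]; rewrite lee_fin -zb /dot !mxE mulr_sumr.
  apply: ler_sum => i _; rewrite !mxE mulrA ler_wpM2r//.
by rewrite lee_fin.
Qed.

Lemma max_relative_gap_le {R : realType} {n} (eps : R) (a : 'cV[int]_n.+1) (D M m : nat) :
    (forall j, covers (fun i => a i ord0) j D) ->
    (forall i, (m <= `|a i ord0| <= M)%N) -> (0 < m)%N ->
  (max_relative_gap eps a <=
    (((2 * n.+1 * D + 1) * M)%:R / m%:R * ((normoo a)%:R `^ eps)^-1)%:E)%E.
Proof.
move=> cov amM m0; apply: ge_ereal_sup => _ [c [c0 _] <-].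
set B : R := _%:R / m%:R.
have GapB : (Gap R c a <= (B * ratr (norm1 c))%:E)%E.
  by apply: ge_ereal_sup => _ [b bP <-]; exact: (IG_le a c b D M m).
have c1 : 0 < ratr (norm1 c) :> R.
  rewrite ltr0q lt_neqAle sumr_ge0// andbT eq_sym psumr_neq0//; apply/hasP.
  have [i ci] : exists i, c i 0 != 0.
    apply: contrapT => nex; move/eqP: c0; apply; apply/colP => i; rewrite mxE.
    by apply/eqP; apply: contrapT => /negP ci; apply: nex; exists i.
  by exists i; rewrite ?mem_index_enum// normr_gt0.
apply: (le_trans (lee_wpmul2r _ GapB)).
  by rewrite lee_fin invr_ge0 mulr_ge0 ?powR_ge0// ltW.
by rewrite -EFinM lee_fin invfM mulrACA mulfV ?gt_eqF// mulr1.
Qed.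

(** * Averaging collisions over coefficient vectors *)

(** A finite type for the nonzero integers of absolute value at most [K]: vectors become finite
    functions with independent coordinates. *)
Definition nzint {K} (v : 'I_K * bool) : int := if v.2 then - (v.1.+1)%:Z else (v.1.+1)%:Z.

Lemma absz_nzint K (v : 'I_K * bool) : `|nzint v|%N = v.1.+1.
Proof. by case: v => i []; rewrite /nzint/= ?abszN. Qed.

Lemma nzint_neq0 K (v : 'I_K * bool) : nzint v != 0.
Proof. by rewrite -absz_gt0 absz_nzint. Qed.

Lemma nzint_inj K : injective (@nzint K).
Proof.
move=> [i b] [j c] /[dup] /(congr1 absz); rewrite !absz_nzint /= => -[/val_inj ->].
by rewrite /nzint; case: b; case: c => //=; lia.
Qed.

Definition upd {I : finType} {V} (f : {ffun I -> V}) l v : {ffun I -> V} :=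
  [ffun i => if i == l then v else f i].

(** Resampling coordinate [l] allows summing over that coordinate first without decomposing the
    function type. *)
Lemma sum_upd {R : realType} {I V : finType} (F : {ffun I -> V} -> R) l :
  \sum_f \sum_v F (upd f l v) = #|V|%:R * \sum_f F f.
Proof.
(* Swapping [f l] with [v] is an involution of the pairs [(f, v)]. *)
pose h (p : {ffun I -> V} * V) := (upd p.1 l p.2, p.1 l).
have hK : involutive h.
  move=> [f v]; rewrite /h /= ffunE eqxx; congr pair.
  by apply/ffunP => i; rewrite !ffunE; case: eqP => // ->.
rewrite pair_big/= (reindex_inj (inv_inj hK))/=.
rewrite mulr_sumr -(pair_bigA _ (fun f v => F (upd (upd f l v) l (f l)))) /=.
apply: eq_bigr => f _; rewrite mulr_natl -sumr_const; apply: eq_bigr => v _.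
by congr F; have /(congr1 fst) := hK (f, v).
Qed.

Definition harmonic_sum (R : realType) K : R := \sum_(i < K) (i.+1%:R)^-1.

(** Stands for the ratio of the largest to the smallest coefficient in the gap bound; its mean is
    the harmonic sum. *)
Definition weight (R : realType) {n K} (k : 'I_n) (f : {ffun 'I_n -> 'I_K * bool}) : R :=
  K%:R / `|nzint (f k)|%N%:R.

Definition pairing {n K} (j : 'I_n) (z : 'I_n -> int) (f : {ffun 'I_n -> 'I_K * bool}) : int :=
  \sum_(i | i != j) nzint (f i) * z i.

Lemma weight_ge0 (R : realType) n K (k : 'I_n) (f : {ffun 'I_n -> 'I_K * bool}) :
  0 <= weight R k f.
Proof. by rewrite divr_ge0. Qed.

Lemma card_signed K : #|{: 'I_K * bool}| = (2 * K)%N.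
Proof. by rewrite card_prod card_ord card_bool mulnC. Qed.

Lemma sum_weight (R : realType) n K (k : 'I_n) : (0 < K)%N ->
  \sum_(f : {ffun 'I_n -> 'I_K * bool}) weight R k f = (2 * K)%:R ^+ n * harmonic_sum R K.
Proof.
move=> K0; have K20 : (2 * K)%:R != 0 :> R by rewrite pnatr_eq0 muln_eq0 -lt0n K0.
apply: (mulfI K20); rewrite -{1}card_signed -(sum_upd _ k).
under eq_bigr => f _.
  rewrite (_ : \sum_v _ = (2 * K)%:R * harmonic_sum R K); last first.
    transitivity (\sum_(v : 'I_K * bool) K%:R / (v.1.+1)%:R : R).
      by apply: eq_bigr => v _; rewrite /weight ffunE eqxx absz_nzint.
    rewrite -(pair_bigA _ (fun (i : 'I_K) (b : bool) => K%:R / i.+1%:R)) /= /harmonic_sum mulr_sumr.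
    by apply: eq_bigr => i _; rewrite sumr_const card_bool -[_ *+ 2]mulr_natl natrM mulrA.
  over.
by rewrite sumr_const card_ffun card_signed card_ord -[LHS]mulr_natl natrX mulrCA.
Qed.

Lemma card_divisors_signed K (w : int) : w != 0 ->
  (#|[pred v : 'I_K * bool | (nzint v %| w)%Z]| <= 2 * size (divisors `|w|))%N.
Proof.
move=> w0; have w1 : (0 < `|w|)%N by rewrite absz_gt0.
have -> : (2 * size (divisors `|w|) = size [seq (d, b) | d <- divisors `|w|, b <- [:: true; false]])%N.
  by rewrite size_allpairs mulnC.
pose s := [seq (v.1.+1, v.2) | v : 'I_K * bool <- enum [pred v | (nzint v %| w)%Z]].
have -> : #|[pred v : 'I_K * bool | (nzint v %| w)%Z]| = size s by rewrite size_map cardE.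
have s_uniq : uniq s.
  by rewrite map_inj_uniq ?enum_uniq// => -[i b] [j c] [/val_inj -> ->].
apply: (uniq_leq_size s_uniq) => y /mapP[v]; rewrite mem_enum inE dvdzE absz_nzint => vw ->.
apply/allpairsP; exists (v.1.+1, v.2); split=> //=; first by rewrite -dvdn_divisors.
by case: (v.2).
Qed.

Lemma pairing_upd_id n K (j : 'I_n) z (f : {ffun 'I_n -> 'I_K * bool}) v :
  pairing j z (upd f j v) = pairing j z f.
Proof. by apply: eq_bigr => i /negbTE ij; rewrite ffunE ij. Qed.

Lemma weight_upd (R : realType) n K (j k : 'I_n) (f : {ffun 'I_n -> 'I_K * bool}) v :
  k != j -> weight R k (upd f j v) = weight R k f.
Proof. by move=> /negbTE kj; rewrite /weight ffunE kj. Qed.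

Lemma sum_nat_of_bool {T : finType} (P : pred T) : (\sum_x P x = #|[pred x | P x]|)%N.
Proof. by rewrite -sum1_card [RHS]big_mkcond; apply: eq_bigr => x _; rewrite inE; case: (P x). Qed.

(* The pairing determines any coordinate [i] with [z i != 0]. The index [k] of the
   weight cannot serve as [i], but if it is the only candidate then the pairing
   never vanishes. *)
Lemma sum_pairing_eq0 (R : realType) n K (j k : 'I_n) (z : 'I_n -> int) :
    (0 < K)%N -> (exists2 l, l != j & z l != 0) ->
  (2 * K)%:R * \sum_(f : {ffun 'I_n -> 'I_K * bool}) weight R k f * (pairing j z f == 0)%:R
    <= (2 * K)%:R ^+ n * harmonic_sum R K.
Proof.
move=> K0 [l lj zl]; rewrite -(sum_weight R n K k K0).
have [[i [ij ik zi]]|only_k] := pselect (exists i, [/\ i != j, i != k & z i != 0]).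
  rewrite -{1}card_signed -(sum_upd _ i); apply: ler_sum => f _.
  under eq_bigr do rewrite weight_upd 1?eq_sym//.
  rewrite -mulr_sumr ler_piMr ?weight_ge0// -natr_sum lern1 sum_nat_of_bool.
  rewrite leqNgt; apply/negP => /card_gt1P[v [w []]]; rewrite !inE => /eqP v0 /eqP w0 /eqP.
  apply; apply: nzint_inj; apply: (mulIf zi).
  have split u : pairing j z (upd f i u) =
      nzint u * z i + \sum_(l | (l != j) && (l != i)) nzint (f l) * z l.
    rewrite /pairing (bigD1 i)//= ffunE eqxx; congr (_ + _).
    by apply: eq_bigr => l' /andP[_ /negbTE li]; rewrite ffunE li.
  by apply: (addIr (\sum_(l | (l != j) && (l != i)) nzint (f l) * z l)); rewrite -!split -v0 -w0.
rewrite big1 ?mulr0 ?sumr_ge0// => [f _|f _]; first exact: weight_ge0.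
rewrite /pairing (bigD1 l)//= big1 ?addr0 => [|i /andP[ij il]]; last first.
  have lk : l = k by apply/eqP; apply: contrapT => /negP lk; apply: only_k; exists l.
  apply/eqP; rewrite mulf_eq0; apply/orP; right; apply: contrapT => /negP zi; apply: only_k.
  by exists i; rewrite -lk.
by rewrite mulf_eq0 (negbTE (nzint_neq0 _ _)) (negbTE zl) mulr0.
Qed.

(* The pairing does not depend on [f j], so summing over [f j] first counts its
   signed divisors. *)
Lemma sum_pairing_dvd (R : realType) n K r T (j k : 'I_n) (z : 'I_n -> int) :
    (0 < K)%N -> k != j -> (forall i, (`|z i| <= r)%N) ->
    (exists2 l, l != j & z l != 0) ->
    (forall w, (0 < w)%N -> (w <= n * K * r)%N -> (size (divisors w) <= T)%N) ->
  \sum_(f : {ffun 'I_n -> 'I_K * bool}) weight R k f * (nzint (f j) %| pairing j z f)%Z%:R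
    <= (2 * K)%:R ^+ n * harmonic_sum R K * (T.+1%:R / K%:R).
Proof.
move=> K0 kj zr zl Tdiv; have K20 : 0 < (2 * K)%:R :> R by rewrite ltr0n muln_gt0.
have K0R : 0 < K%:R :> R by rewrite ltr0n.
rewrite -(ler_pM2l K20) -{1}card_signed -(sum_upd _ j).
have small (f : {ffun 'I_n -> 'I_K * bool}) : (`|pairing j z f| <= n * K * r)%N.
  rewrite -lez_nat abszE (le_trans (ler_norm_sum _ _ _))//.
  apply: (@le_trans _ _ (\sum_(i : 'I_n) (K * r)%N%:Z)); last first.
    by rewrite sumr_const card_ord -mulr_natl natz -PoszM mulnA.
  rewrite big_mkcond/=; apply: ler_sum => i _; case: ifP => // _.
  rewrite -abszE lez_nat abszM absz_nzint; exact: leq_mul (ltn_ord (f i).1) (zr i).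
(* A nonzero pairing is divisible by at most [2 T] values of [f j]. A zero pairing admits all [2 K],
   a case paid for by [sum_pairing_eq0]. *)
apply: (@le_trans _ _ (\sum_(f : {ffun 'I_n -> 'I_K * bool})
    (weight R k f * (2 * T)%:R + (2 * K)%:R * (weight R k f * (pairing j z f == 0)%:R)))).
  apply: ler_sum => f _; under eq_bigr do rewrite weight_upd// pairing_upd_id ffunE eqxx.
  rewrite -mulr_sumr mulrCA -mulrDr ler_wpM2l ?weight_ge0// -natr_sum -natrM -natrD ler_nat.
  rewrite sum_nat_of_bool; have [->|w0] := eqVneq (pairing j z f) 0.
    by rewrite muln1 (leq_trans (max_card _))// card_signed leq_addl.
  rewrite muln0 addn0 (leq_trans (card_divisors_signed _ _ w0))// leq_mul2l Tdiv//.
  by rewrite absz_gt0.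
rewrite big_split/=.
have <- : (2 * K)%:R * \sum_(f : {ffun 'I_n -> 'I_K * bool}) weight R k f * (pairing j z f == 0)%:R
    = \sum_(f : {ffun 'I_n -> 'I_K * bool}) (2 * K)%:R * (weight R k f * (pairing j z f == 0)%:R).
  by rewrite mulr_sumr.
rewrite -mulr_suml sum_weight//.
apply: (le_trans (lerD (lexx _) (sum_pairing_eq0 R n K j k z K0 zl))).
set X := _ * harmonic_sum R K.
have X0 : 0 <= X by rewrite mulr_ge0 ?exprn_ge0 ?sumr_ge0.
have -> : (2 * K)%:R * (X * (T.+1%:R / K%:R)) = X * (2 * T.+1)%:R.
  by rewrite !natrM; field; rewrite gt_eqF.
apply: (@le_trans _ _ (X * (2 * T + 1)%:R)); first by rewrite natrD mulrDr mulr1.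
by rewrite ler_wpM2l// ler_nat; lia.
Qed.

(** After exchanging sums, pairs agreeing off [j] collide for every [f], but there are at most
    [r.+1 ^ n * r.+1] of them. Every other pair has a nonzero difference off [j] and falls under
    [sum_pairing_dvd]. *)
Lemma sum_weight_collisions (R : realType) n K r T (j k : 'I_n) :
    (0 < K)%N -> k != j ->
    (forall w, (0 < w)%N -> (w <= n * K * r)%N -> (size (divisors w) <= T)%N) ->
  \sum_(f : {ffun 'I_n -> 'I_K * bool}) weight R k f *
      #|[pred p | @collides n r (fun i => nzint (f i)) j p]|%:R
    <= (2 * K)%:R ^+ n * harmonic_sum R K *
       ((r.+1 ^ n * r.+1)%:R + ((r.+1 ^ n) ^ 2)%:R * (T.+1%:R / K%:R)).
Proof.
move=> K0 kj Tdiv.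
under eq_bigr do rewrite -sum_nat_of_bool natr_sum mulr_sumr.
rewrite exchange_big/=.
pose agree (p : {ffun 'I_n -> 'I_r.+1} * {ffun 'I_n -> 'I_r.+1}) :=
  [forall i, (i != j) ==> (p.1 i == p.2 i)].
set X := _ * harmonic_sum R K.
have X0 : 0 <= X by rewrite mulr_ge0 ?exprn_ge0 ?sumr_ge0.
have card_agree : (#|[pred p | agree p]| <= r.+1 ^ n * r.+1)%N.
  have <- : #|{: {ffun 'I_n -> 'I_r.+1} * 'I_r.+1}| = (r.+1 ^ n * r.+1)%N.
    by rewrite card_prod card_ffun !card_ord.
  rewrite -(card_in_imset (f := fun p : {ffun 'I_n -> 'I_r.+1} * {ffun 'I_n -> 'I_r.+1} => (p.1, p.2 j))) ?max_card//.
  move=> [x y] [x' y']; rewrite !inE => /forallP xy /forallP xy' /= [xx yj]; rewrite -xx; congr pair.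
  apply/ffunP => i; have [->//|ij] := eqVneq i j.
  by have := xy i; have := xy' i; rewrite ij /= => /eqP <- /eqP <-; rewrite xx.
have card_all : #|{: {ffun 'I_n -> 'I_r.+1} * {ffun 'I_n -> 'I_r.+1}}| = ((r.+1 ^ n) ^ 2)%N.
  by rewrite card_prod card_ffun !card_ord mulnn.
rewrite (bigID agree)/= mulrDr; apply: lerD.
  apply: (@le_trans _ _ (\sum_(p | agree p) X)); last first.
    by rewrite sumr_const -[X in X <= _]mulr_natr ler_wpM2l// ler_nat.
  apply: ler_sum => p _; rewrite /X -(sum_weight R n K k K0); apply: ler_sum => f _.
  by rewrite ler_piMr ?weight_ge0// lern1 leq_b1.
apply: (@le_trans _ _ (\sum_(p | ~~ agree p) X * (T.+1%:R / K%:R))); last first.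
  rewrite sumr_const -[X in X <= _]mulr_natr mulrAC -mulrA ler_wpM2l//.
  by rewrite ler_wpM2r ?divr_ge0// ler_nat -card_all max_card.
apply: ler_sum => p /forallPn[l]; rewrite negb_imply => /andP[lj xy].
pose z i := (p.1 i)%:Z - (p.2 i)%:Z.
apply: (sum_pairing_dvd R n K r T j k z K0 kj) => //.
- by move=> i; rewrite /z; have := ltn_ord (p.1 i); have := ltn_ord (p.2 i); lia.
- by exists l; rewrite // subr_eq0; apply: contraNneq xy => -[/val_inj ->].
Qed.

(** * Primitive vectors and their density *)

Definition nzvec {n K} (f : {ffun 'I_n -> 'I_K * bool}) : 'cV[int]_n := \col_i nzint (f i).

Lemma nzvec_inj n K : injective (@nzvec n K).
Proof.
move=> f g /colP fg; apply/ffunP => i; apply: nzint_inj.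
by have := fg i; rewrite !mxE.
Qed.

Lemma nzvec_onto n K (a : 'cV[int]_n) : (forall i, a i ord0 != 0) -> (normoo a <= K)%N ->
  exists f : {ffun 'I_n -> 'I_K * bool}, a = nzvec f.
Proof.
move=> a0 aK; have aiK i : (`|a i ord0| <= K)%N.
  exact: leq_trans (leq_bigmax (F := fun i => `|a i ord0|%N) i) aK.
have ai i : (`|a i ord0|.-1 < K)%N by rewrite prednK ?absz_gt0// aiK.
exists [ffun i => (Ordinal (ai i), a i ord0 < 0)]; apply/colP => i.
rewrite mxE ffunE /nzint/= prednK ?absz_gt0//.
by rewrite (ord1 _); case: ltP => [/ltz0_abs ->|/gez0_abs -> //]; rewrite opprK.
Qed.

Lemma normoo_nzvec n K (f : {ffun 'I_n -> 'I_K * bool}) : (normoo (nzvec f) <= K)%N.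
Proof. by apply/bigmax_leqP => i _; rewrite mxE absz_nzint ltn_ord. Qed.

Lemma Q_natP (R : realType) n (H : R) (a : 'cV[int]_n) : 0 <= H ->
  Q n H a <-> [/\ forall i, a i ord0 != 0,
     \big[gcdn/0%N]_(i < n) `|a i ord0|%N = 1%N & (normoo a <= Num.truncn H)%N].
Proof.
by move=> H0; split=> -[a0 g1 aH]; split=> //; move: aH; rewrite truncn_ge_nat.
Qed.

Lemma ler_sum_subset (R : realType) (T : eqType) (s t : seq T) (g : T -> R) :
  uniq s -> uniq t -> {subset s <= t} -> (forall x, 0 <= g x) ->
  \sum_(x <- s) g x <= \sum_(x <- t) g x.
Proof.
move=> us ut st g0.
have P : perm_eq s [seq x <- t | x \in s].
  apply: uniq_perm => //; first exact: filter_uniq.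
  by move=> x; rewrite mem_filter; case: (boolP (x \in s)) => // /st ->.
rewrite (perm_big _ P) big_filter [leRHS](bigID (mem s))/= lerDl sumr_ge0//.
Qed.

Lemma sum_Q_le (R : realType) n (H : R) (g : 'cV[int]_n -> R) : 0 <= H -> (forall a, 0 <= g a) ->
  \sum_(a <- fset_set (Q n H)) g a <=
  \sum_(f : {ffun 'I_n -> 'I_(Num.truncn H) * bool}) g (nzvec f).
Proof.
move=> H0 g0; rewrite -(big_map (@nzvec n (Num.truncn H)) predT g).
apply: ler_sum_subset => //.
- by rewrite map_inj_uniq ?index_enum_uniq//; exact: nzvec_inj.
- move=> a; rewrite in_fset_set ?inE; last exact: finite_Q.
  move=> /(Q_natP _ _ _ _ H0)[a0 _ aK]; have [f ->] := nzvec_onto n _ a a0 aK.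
  by apply: map_f; rewrite mem_index_enum.
Qed.

Lemma card_multiples K d : (0 < d)%N ->
  (#|[pred v : 'I_K * bool | (d %| v.1.+1)%N]| <= 2 * (K %/ d))%N.
Proof.
move=> d0.
pose t := [seq ((d * m)%N, b) | m <- iota 1 (K %/ d), b <- [:: true; false]].
have -> : (2 * (K %/ d) = size t)%N by rewrite size_allpairs size_iota mulnC.
pose s := [seq (v.1.+1, v.2) | v : 'I_K * bool <- enum [pred v : 'I_K * bool | (d %| v.1.+1)%N]].
have -> : #|[pred v : 'I_K * bool | (d %| v.1.+1)%N]| = size s by rewrite size_map cardE.
have s_uniq : uniq s.
  by rewrite map_inj_uniq ?enum_uniq// => -[i b] [j c] [/val_inj -> ->].
apply: (uniq_leq_size s_uniq) => y /mapP[v]; rewrite mem_enum inE => /dvdnP[m mE] ->.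
apply/allpairsP; exists (m, v.2); split=> /=; last by rewrite mE mulnC.
- rewrite mem_iota add1n ltnS leq_divRL// -mE ltn_ord andbT.
  by case: m mE => //; rewrite mul0n.
- by case: (v.2).
Qed.

(** Telescoping: with [x = m + 1], [1 / (x + 1) ^ 3 <= 1 / (2 x (x + 1))]. The bound stays below
    [1 / 2], as [N_ge] needs. *)
Lemma sum_inv_cube_le (R : realType) n m : (3 <= n)%N ->
  \sum_(2 <= d < m.+2) (d%:R ^+ n)^-1 <= 2^-1 - (2 * m.+1%:R)^-1 :> R.
Proof.
move=> n3; elim: m => [|m IH]; first by rewrite big_nil mulr1 subrr.
rewrite big_nat_recr//=; apply: (le_trans (lerD IH (lexx _))).
have cube : ((m.+2%:R ^+ n)^-1 <= (m.+2%:R ^+ 3)^-1 :> R).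
  by rewrite lef_pV2 ?posrE ?exprn_gt0// ler_eXn2l// ltr1n.
suff : (m.+2%:R ^+ 3)^-1 <= (2 * m.+1%:R)^-1 - (2 * m.+2%:R)^-1 :> R.
  move: cube; move: (m.+2%:R ^- n) (m.+2%:R ^- 3) (2 * m.+1%:R)^-1 (2 * m.+2%:R)^-1.
  by move=> u v w z; lra.
have x0 : 0 < m.+1%:R :> R by rewrite ltr0n.
have x1 : 1 <= m.+1%:R :> R by rewrite ler1n.
rewrite -(natr1 m.+1); move: (m.+1%:R : R) x0 x1 => x x0 x1.
have -> : (2 * x)^-1 - (2 * (x + 1))^-1 = (2 * x * (x + 1))^-1 by field; lra.
rewrite lef_pV2 ?posrE ?exprn_gt0 ?mulr_gt0//; try lra.
by rewrite !exprS expr0; nra.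
Qed.

(** At least half of the [(2 K) ^ n] vectors are primitive. The gcd [d >= 2] of any other vector
    divides all its entries, which leaves at most [(2 K / d) ^ n] vectors for each [d]; sum over
    [d]. *)
Lemma N_ge (R : realType) n (H : R) : (3 <= n)%N -> 1 <= H ->
  (2 * Num.truncn H)%:R ^+ n / 2 <= (N n H)%:R :> R.
Proof.
move=> n3 H1; set K := Num.truncn H; have H0 : 0 <= H by lra.
have K0 : (0 < K)%N by rewrite truncn_gt0.
pose G (f : {ffun 'I_n -> 'I_K * bool}) := (\big[gcdn/0%N]_(i < n) (f i).1.+1)%N.
have NG : (#|[pred f | G f == 1%N]| <= N n H)%N.
  rewrite /N cardE -(size_map nzvec); apply: uniq_leq_size.
    by rewrite map_inj_uniq ?enum_uniq//; exact: nzvec_inj.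
  move=> a /mapP[f]; rewrite mem_enum inE => /eqP Gf ->.
  rewrite in_fset_set ?inE; last exact: finite_Q.
  apply/Q_natP => //; split; last exact: normoo_nzvec.
  - by move=> i; rewrite mxE nzint_neq0.
  - by rewrite -[RHS]Gf; apply: eq_bigr => i _; rewrite mxE absz_nzint.
have bad : (#|[pred f | G f != 1%N]| <= \sum_(2 <= d < K.+1) (2 * (K %/ d)) ^ n)%N.
  rewrite -sum_nat_of_bool.
  apply: (@leq_trans (\sum_(f : {ffun 'I_n -> 'I_K * bool}) \sum_(2 <= d < K.+1)
      (f \in ffun_on [pred v : 'I_K * bool | (d %| v.1.+1)%N]))%N).
    apply: leq_sum => f _; case: (boolP (G f != 1%N)) => // G1.
    have Gdvd i : (G f %| (f i).1.+1)%N by rewrite /G (bigD1 i)//= dvdn_gcdl.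
    have i0 : 'I_n by exists 0%N; lia.
    have GK : (1 < G f < K.+1)%N.
      have : (0 < G f <= K)%N.
        by rewrite (dvdn_gt0 _ (Gdvd i0))//= (leq_trans (dvdn_leq _ (Gdvd i0)))// ltn_ord.
      by move: G1; case: (G f) => [|[]].
    rewrite (bigD1_seq (G f)) ?mem_index_iota ?iota_uniq//=.
    suff -> : f \in ffun_on [pred v : 'I_K * bool | (G f %| v.1.+1)%N] by [].
    by apply/ffun_onP => i; rewrite inE.
  rewrite exchange_big/= big_nat_cond [leqRHS]big_nat_cond; apply: leq_sum => d /andP[/andP[d2 _] _].
  rewrite sum_nat_of_bool.
  have -> : #|[pred f : {ffun 'I_n -> 'I_K * bool} | f \in
      ffun_on [pred v : 'I_K * bool | (d %| v.1.+1)%N]]| =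
      (#|[pred v : 'I_K * bool | (d %| v.1.+1)%N]| ^ n)%N.
    by rewrite -[in RHS](card_ord n) -card_ffun_on; apply: eq_card.
  by rewrite leq_exp2r ?card_multiples//; lia.
have total : ((2 * K) ^ n = #|[pred f | G f == 1%N]| + #|[pred f | G f != 1%N]|)%N.
  by rewrite -card_signed -[X in (_ ^ X)%N](card_ord n) -card_ffun -(cardC [pred f | G f == 1%N]).
have badR : #|[pred f | G f != 1%N]|%:R <= (2 * K)%:R ^+ n / 2 :> R.
  apply: (@le_trans _ _ (\sum_(2 <= d < K.+1) (2 * K)%:R ^+ n * (d%:R ^+ n)^-1)).
    rewrite -(ler_nat R) in bad; apply: (le_trans bad); rewrite natr_sum.
    rewrite big_nat_cond [leRHS]big_nat_cond; apply: ler_sum => d /andP[/andP[d2 _] _].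
    have d0 : 0 < d%:R :> R by rewrite ltr0n; lia.
    rewrite natrX -exprVn -exprMn lerXn2r ?nnegrE ?divr_ge0// ler_pdivlMr// -natrM ler_nat.
    by rewrite -mulnA leq_mul2l leq_divM.
  rewrite -mulr_sumr ler_wpM2l ?exprn_ge0//.
  have := sum_inv_cube_le R n K.-1 n3; rewrite prednK// => /le_trans; apply.
  by rewrite gerBl invr_ge0 mulr_ge0.
have totalR : (2 * K)%:R ^+ n = #|[pred f | G f == 1%N]|%:R + #|[pred f | G f != 1%N]|%:R :> R.
  by rewrite -natrX total natrD.
have : #|[pred f | G f == 1%N]|%:R <= (N n H)%:R :> R by rewrite ler_nat.
lra.
Qed.

(** * A majorant linear in the collisions, and its mean *)

Lemma covers_leq {n} (a : 'I_n -> int) (j : 'I_n) (D E : nat) :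
  (D <= E)%N -> covers a j D -> covers a j E.
Proof. by move=> DE cov v; have [x xD dx] := cov v; exists x => // i; exact: leq_trans DE. Qed.

(** Summing over all [j] and [k] replaces the choice of the worst modulus and the smallest entry,
    which depends on [a]. The constant 18 is 3 from [2 n D + 1 <= 3 n D] times 6 from
    [covers_collisions]. Requiring [k != j] keeps the weight independent of [a j], the entry summed
    first. *)
Definition gap_majorant (R : realType) {n} (K r : nat) (a : 'cV[int]_n) : R :=
  (18 * n * r * K)%:R / ((r.+1 ^ n) ^ 2)%:R *
  \sum_j \sum_(k | k != j) K%:R / `|a k ord0|%N%:R *
    #|[pred p | @collides n r (fun i => a i ord0) j p]|%:R.

Lemma gap_majorant_ge0 (R : realType) n K r (a : 'cV[int]_n) : 0 <= gap_majorant R K r a.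
Proof.
by rewrite mulr_ge0 ?divr_ge0// sumr_ge0// => j _; rewrite sumr_ge0// => k _; rewrite mulr_ge0.
Qed.

Lemma max_relative_gap_majorant (R : realType) n K r (eps : R) (a : 'cV[int]_n) :
    (1 < n)%N -> (0 < r)%N -> (forall i, a i ord0 != 0) ->
    \big[gcdn/0%N]_(i < n) `|a i ord0|%N = 1%N -> (normoo a <= K)%N ->
  (max_relative_gap eps a <= (gap_majorant R K r a * ((normoo a)%:R `^ eps)^-1)%:E)%E.
Proof.
case: n a => // n a n1 r0 a0 g1 aK.
have aiK i : (`|a i ord0| <= K)%N.
  exact: leq_trans (leq_bigmax (F := fun i => `|a i ord0|%N) i) aK.
have apos i : (0 < `|a i ord0|)%N by rewrite absz_gt0.
have aposR i : 0 < `|a i ord0|%N%:R :> R by rewrite ltr0n.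
have /choice[D DP] := fun j => covers_collisions (fun i => a i ord0) j r (a0 j) g1 r0.
have [j jmax] : exists j, forall i, (D i <= D j)%N.
  by case: (arg_maxnP (P := predT) D (isT : predT (ord0 : 'I_n.+1))) => j _ jP; exists j => i; exact: jP.
have [l lmin] : exists l, forall i, (`|a l ord0| <= `|a i ord0|)%N.
  case: (arg_minnP (P := predT) (fun i => `|a i ord0|%N) (isT : predT (ord0 : 'I_n.+1))) => l _ lP.
  by exists l => i; exact: lP.
(* All ratios [K / |a i|] are at least 1. If the smallest entry is not at [j], take [k = l];
   otherwise any [k != j] works. The extra factor [1 / |a j|] will cancel the [|a j|] in the bound
   for [D j]. *)
have [k kj kE] : exists2 k, k != j & (K%:R / `|a l ord0|%N%:R <=
    K%:R / `|a j ord0|%N%:R * (K%:R / `|a k ord0|%N%:R) :> R).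
  have ge1 i : 1 <= K%:R / `|a i ord0|%N%:R :> R by rewrite ler_pdivlMr// mul1r ler_nat.
  have [->|lj] := eqVneq l j; last by exists l; rewrite // ler_peMl.
  have [k kj] : exists k : 'I_n.+1, k != j.
    exists (if j == ord0 then ord_max else ord0).
    by case: (eqVneq j ord0) => [->|]; rewrite 1?eq_sym// -val_eqE /=; lia.
  by exists k; rewrite // ler_peMr.
have [_ Dj0 Dj] := DP j.
apply: (le_trans (max_relative_gap_le eps a (D j) K `|a l ord0|%N _ _ _)) => //.
- by move=> i; have [cov _ _] := DP i; exact: covers_leq (jmax i) cov.
- by move=> i; rewrite lmin aiK.
rewrite lee_fin ler_wpM2r ?invr_ge0 ?powR_ge0//.
set c := #|[pred p | @collides n.+1 r (fun i => a i ord0) j p]| in Dj.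
set S := ((r.+1 ^ n.+1) ^ 2)%N in Dj *.
have S0 : 0 < S%:R :> R by rewrite ltr0n !expn_gt0.
have DjR : (D j)%:R <= (6 * r * `|a j ord0| * c)%:R / S%:R :> R.
  by rewrite ler_pdivlMr// -natrM ler_nat.
apply: (@le_trans _ _ ((3 * n.+1 * D j)%:R * (K%:R / `|a j ord0|%N%:R * (K%:R / `|a k ord0|%N%:R)))).
  rewrite natrM -mulrA ler_pM ?divr_ge0// ler_nat; nia.
apply: (@le_trans _ _ ((18 * n.+1 * r * K)%:R / S%:R * (K%:R / `|a k ord0|%N%:R * c%:R))); last first.
  rewrite ler_wpM2l ?divr_ge0// (bigD1 j)//= (bigD1 k)//= -addrA lerDl addr_ge0//.
    by rewrite sumr_ge0// => i _; rewrite mulr_ge0.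
  by rewrite sumr_ge0// => i _; rewrite sumr_ge0// => i' _; rewrite mulr_ge0.
apply: (@le_trans _ _ ((3 * n.+1)%:R * ((6 * r * `|a j ord0| * c)%:R / S%:R) *
    (K%:R / `|a j ord0|%N%:R * (K%:R / `|a k ord0|%N%:R)))).
  by rewrite ler_wpM2r ?mulr_ge0// natrM ler_wpM2l.
have := aposR j; have := aposR k; rewrite !natrM.
move: (`|a j ord0|%N%:R : R) (`|a k ord0|%N%:R : R) (n.+1%:R : R) => u v w v0 u0.
by rewrite le_eqVlt; apply/orP; left; apply/eqP; field; rewrite !gt_eqF.
Qed.

(** The condition [K <= r.+1 ^ n.-1] makes the trivial collisions at most [S / K], so they only turn
    [T.+1] into [T.+2]. The at most [n ^ 2] pairs [(j, k)] then give the factor [n ^ 3]. *)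
Lemma sum_gap_majorant (R : realType) n K r T : (0 < K)%N -> (0 < n)%N -> (K <= r.+1 ^ n.-1)%N ->
    (forall w, (0 < w)%N -> (w <= n * K * r)%N -> (size (divisors w) <= T)%N) ->
  \sum_(f : {ffun 'I_n -> 'I_K * bool}) gap_majorant R K r (nzvec f) <=
    (18 * n ^ 3 * r * T.+2)%:R * harmonic_sum R K * (2 * K)%:R ^+ n.
Proof.
move=> K0 n0 Kr Tdiv; have K0R : 0 < K%:R :> R by rewrite ltr0n.
set S := ((r.+1 ^ n) ^ 2)%N; have S0 : 0 < S%:R :> R by rewrite ltr0n !expn_gt0.
set X := (2 * K)%:R ^+ n * harmonic_sum R K.
have X0 : 0 <= X by rewrite mulr_ge0 ?exprn_ge0 ?sumr_ge0.
have rK : (r.+1 ^ n * r.+1)%:R <= S%:R / K%:R :> R.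
  rewrite ler_pdivlMr// -natrM ler_nat /S -mulnn -{3}(prednK n0) expnS.
  by rewrite -!mulnA leq_mul2l leq_mul2l Kr !orbT.
have pair j k : k != j -> \sum_(f : {ffun 'I_n -> 'I_K * bool})
    K%:R / `|nzvec f k ord0|%N%:R *
      #|[pred p | @collides n r (fun i => nzvec f i ord0) j p]|%:R <= X * (S%:R * (T.+2%:R / K%:R)).
  move=> kj; have := sum_weight_collisions R n K r T j k K0 kj Tdiv; rewrite -/X -/S => le1.
  rewrite (eq_bigr (fun f => weight R k f *
      #|[pred p | @collides n r (fun i => nzint (f i)) j p]|%:R)); last first.
    by move=> f _; rewrite /weight mxE; congr (_ * _%:R); apply: eq_card => p;
      rewrite !inE /collides mxE; congr (_ %| _)%Z; apply: eq_bigr => i _; rewrite mxE.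
  apply: (le_trans le1); rewrite ler_wpM2l// -(natr1 T.+1) mulrDl mulrDr addrC lerD2l.
  by rewrite mul1r.
rewrite -mulr_sumr exchange_big/=.
apply: (@le_trans _ _ ((18 * n * r * K)%:R / S%:R * \sum_(j < n) \sum_(k < n) X * (S%:R * (T.+2%:R / K%:R)))).
  rewrite ler_wpM2l ?divr_ge0//; apply: ler_sum => j _; rewrite exchange_big/=.
  rewrite big_mkcond/=; apply: ler_sum => k _; case: ifP => [kj|_]; first exact: pair.
  by rewrite mulr_ge0// mulr_ge0// divr_ge0.
rewrite !sumr_const !card_ord -[_ *+ n]mulr_natl -[_ *+ n]mulr_natl /X !natrM !natrX.
by rewrite le_eqVlt; apply/orP; left; apply/eqP; field; rewrite ?gt_eqF.
Qed.

Lemma harmonic_sum_le (R : realType) (s : R) K : 0 < s -> (0 < K)%N ->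
  harmonic_sum R K <= (1 + s^-1) * K%:R `^ s.
Proof.
move=> s0; case: K => // K _.
have ln_le : harmonic_sum R K.+1 <= 1 + ln K.+1%:R.
  elim: K => [|K IH]; first by rewrite /harmonic_sum big_ord1 invr1 ln1 addr0.
  rewrite /harmonic_sum big_ord_recr/= -/(harmonic_sum R K.+1).
  apply: (le_trans (lerD IH (lexx _))); rewrite -addrA lerD2l.
  set x : R := K.+2%:R; have x1 : 1 < x by rewrite ltr1n.
  have K1 : K.+1%:R = x * (1 - x^-1) :> R.
    by rewrite mulrBr mulr1 mulfV ?gt_eqF ?(lt_trans ltr01)// /x -[K.+2%:R]natr1 addrK.
  have xV : x^-1 < 1 by rewrite invf_lt1 ?(lt_trans ltr01).
  (* With [x = K + 2]: [ln (x - 1) = ln x + ln (1 - 1 / x) <= ln x - 1 / x]. *)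
  rewrite K1 lnM ?posrE ?subr_gt0//.
  have : -1 < - x^-1 by rewrite ltrN2.
  by move=> /le_ln1Dx h; rewrite -addrA gerDl -lerBrDr sub0r.
apply: (le_trans ln_le); rewrite /powR pnatr_eq0/=.
have := expR_ge1Dx (s * ln K.+1%:R); set l := ln _; set e := expR _ => el.
have l0 : 0 <= l by rewrite ln_ge0// ler1n.
have sV : 0 < s^-1 by rewrite invr_gt0.
apply: (@le_trans _ _ ((1 + s^-1) * (1 + s * l))); last by rewrite ler_wpM2l//; lra.
have -> : (1 + s^-1) * (1 + s * l) = 1 + l + (s^-1 + s * l) by field; rewrite gt_eqF.
by rewrite lerDl addr_ge0 ?mulr_ge0// ltW.
Qed.

Lemma majorant_average (R : realType) n : (3 <= n)%N ->
  exists2 C : R, 0 < C & forall K, (0 < K)%N -> exists2 r, (0 < r)%N &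
    \sum_(f : {ffun 'I_n -> 'I_K * bool}) gap_majorant R K r (nzvec f) <=
      C * K%:R `^ (2 / n%:R) * (2 * K)%:R ^+ n.
Proof.
move=> n3; have n_gt0 : (0 < n)%N by exact: leq_trans n3.
have n0 : 0 < n%:R :> R by rewrite ltr0n.
have n1 : 0 < n.-1%:R :> R by rewrite ltr0n; lia.
pose e : R := (n.-1%:R)^-1; have e0 : 0 < e by rewrite invr_gt0.
have e1 : e <= 1 by rewrite invf_le1// ler1n; lia.
(* A third of the slack in the exponent: one [s] pays for the harmonic sum, two
   for the divisor bound at arguments of order [K ^ 2]. *)
pose s : R := (2 / n%:R - e) / 3.
have s0 : 0 < s.
  rewrite divr_gt0// subr_gt0 ltr_pdivlMr// mulrC ltr_pdivrMr// -natrM ltr_nat; lia.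
have [C1 C11 div_le] := divisor_bound R s s0.
have sV : 0 < s^-1 by rewrite invr_gt0.
have ns : 0 < n%:R `^ s :> R by rewrite powR_gt0.
exists ((18 * n ^ 3)%:R * 3 * C1 * n%:R `^ s * (1 + s^-1)).
  rewrite !mulr_gt0 ?ltr0n ?muln_gt0 ?expn_gt0 ?addr_gt0//; [lia|lra].
move=> K K0; have K1 : 1 <= K%:R :> R by rewrite ler1n.
have KD x y : K%:R `^ (x + y) = K%:R `^ x * K%:R `^ y :> R.
  by rewrite powRD// pnatr_eq0 -lt0n K0 implybT.
pose u : R := K%:R `^ e.
have u0 : 0 <= u by exact: powR_ge0.
have u1 : 1 <= u by rewrite -(powRr0 K%:R) ler_powR// ltW.
have uK : u <= K%:R by rewrite ler1_powR.
(* The integer part of [K ^ (1 / (n - 1))]: large enough for [sum_gap_majorant], and at most [K], so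
   the divisor bound is applied up to [n K ^ 2]. *)
have [r [r0 ru Kr]] : exists r, [/\ (0 < r)%N, r%:R <= u & (K <= r.+1 ^ n.-1)%N].
  exists (Num.truncn u); split; rewrite ?truncn_gt0 ?truncn_le//.
  rewrite -(ler_nat R) natrX; have -> : K%:R = u ^+ n.-1 :> R.
    by rewrite -powR_mulrn// /u -powRrM mulVf ?gt_eqF// powRr1.
  by rewrite lerXn2r ?nnegrE// ltW// truncnS_gt.
exists r => //.
have [Y YE] : exists Y : R, Y = (n * K * r)%:R `^ s by eexists.
have Y1 : 1 <= Y.
  rewrite YE -[leLHS](powRr0 (n * K * r)%:R) ler_powR ?(ltW s0)//.
  by rewrite ler1n !muln_gt0 n_gt0 K0 r0.
have YK : Y <= n%:R `^ s * K%:R `^ (2 * s).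
  have -> : 2 * s = s + s by ring.
  rewrite KD YE !natrM !powRM ?mulr_ge0// -mulrA ler_wpM2l ?powR_ge0//.
  rewrite ler_wpM2l ?powR_ge0// ge0_ler_powR ?nnegrE ?(ltW s0)//.
  exact: le_trans ru uK.
have C10 : 0 <= C1 by exact: le_trans C11.
have CY1 : 1 <= C1 * Y by rewrite -[1]mulr1 ler_pM.
have CY0 : 0 <= C1 * Y by exact: le_trans CY1.
have [T TC Tdiv] : exists2 T, T%:R <= C1 * Y & forall w, (0 < w)%N ->
    (w <= n * K * r)%N -> (size (divisors w) <= T)%N.
  exists (Num.truncn (C1 * Y)); first by rewrite truncn_le.
  move=> w w0 wle; rewrite truncn_ge_nat// (le_trans (div_le w w0))//.
  by rewrite ler_wpM2l// YE ge0_ler_powR ?nnegrE ?(ltW s0)// ler_nat.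
apply: (le_trans (sum_gap_majorant R n K r T K0 n_gt0 Kr Tdiv)).
rewrite ler_wpM2r ?exprn_ge0//.
(* Both [T] and 1 are at most [C1 * Y], hence the factor 3. *)
have T2 : T.+2%:R <= 3 * C1 * Y by rewrite -addn2 natrD; lra.
have -> : K%:R `^ (2 / n%:R) = u * (K%:R `^ (2 * s) * K%:R `^ s).
  by rewrite /u -!KD; congr (_ `^ _); rewrite /s; field; rewrite gt_eqF.
have hK := harmonic_sum_le R s K s0 K0.
have h0 : 0 <= harmonic_sum R K by rewrite sumr_ge0.
rewrite (natrM _ (_ * _)) (natrM _ (18 * n ^ 3)).
have s1 : 0 <= 1 + s^-1 by rewrite addr_ge0// ltW.
apply: (@le_trans _ _ ((18 * n ^ 3)%:R * u * (3 * C1 * (n%:R `^ s * K%:R `^ (2 * s))) *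
    ((1 + s^-1) * K%:R `^ s))).
  apply: ler_pM => //.
  apply: ler_pM => //; first by rewrite ler_wpM2l.
  by apply: (le_trans T2); rewrite ler_wpM2l// mulr_ge0.
by rewrite le_eqVlt; apply/orP; left; apply/eqP; ring.
Qed.

(** * Dyadic decomposition and conclusion *)

(** Strong induction, halving [K]. The inner part costs [4 C (2 (K %/ 2)) ^ n], at most half of the
    target, and the outer shell costs the other half, [2 C (2 K) ^ n]. The constant is uniform in
    [eps], since [|a|_oo >= 1] allows replacing [eps] by [2 / n]. *)
Lemma sum_max_relative_gap_le (R : realType) n : (3 <= n)%N ->
  exists2 C : R, 0 < C & forall eps, 2 / n%:R < eps -> forall K,
    (\sum_(a \in Q n (K%:R : R)) max_relative_gap eps a <= (C * (2 * K)%:R ^+ n)%:E)%E.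
Proof.
move=> n3; have [C C0 avg] := majorant_average R n n3.
exists (4 * C) => [|eps eps_gt]; first by rewrite mulr_gt0.
have n_gt0 : (0 < n)%N by exact: leq_trans n3.
have n0 : 0 < n%:R :> R by rewrite ltr0n.
have e0 : 0 <= 2 / n%:R :> R by rewrite divr_ge0.
have e1 : 2 / n%:R <= 1 :> R by rewrite ler_pdivrMr// mul1r ler_nat; lia.
elim/ltn_ind => K IH; have [->|K0] := posnP K.
  rewrite fsbig1 ?lee_fin ?mulr_ge0 ?exprn_ge0 ?(ltW C0)// => a.
  case=> a0 g1 /=; rewrite ler_nat leqn0 => /eqP aK.
  exfalso; have i0 : 'I_n by exists 0%N; lia.
  have := leq_bigmax (F := fun i => `|a i ord0|%N) i0; rewrite -/(normoo a) aK leqn0 absz_eq0.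
  by apply/negP.
have QnatP (L : nat) (a : 'cV[int]_n) : Q n (L%:R : R) a -> (normoo a <= L)%N.
  by case=> _ _; rewrite /= ler_nat.
pose A := Q n (K%:R : R); pose B := Q n ((K %/ 2)%:R : R).
have finA : finite_set A by exact: finite_Q.
have AB : A `&` B = B.
  apply/seteqP; split=> [a []//|a Ba]; split => //.
  case: (Ba) => a0 g1 aB; split => //; apply: (le_trans aB); rewrite ler_nat; lia.
rewrite (fsbigID B)//= AB.
apply: (@le_trans _ _ ((4 * C * (2 * (K %/ 2))%:R ^+ n)%:E +
    (2 * C * (2 * K)%:R ^+ n)%:E)%E); last first.
  rewrite -EFinD lee_fin.
  have : (2 * (2 * (K %/ 2))%:R ^+ n <= (2 * K)%:R ^+ n :> R).
    rewrite -!natrX -natrM ler_nat (@leq_trans (2 ^ n * (2 * (K %/ 2)) ^ n))//.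
      by apply: leq_mul; rewrite // -[leqLHS](expn1 2) leq_pexp2l.
    by rewrite -expnMn leq_exp2r//; lia.
  move=> /(ler_wpM2l (ltW C0)); lra.
apply: leeD; first by apply: IH; lia.
have [r r0 avgK] := avg K K0.
have finAB : finite_set (A `&` ~` B) by exact: finite_setIl.
(* Bounds [|a|_oo ^ - eps] on the shell: there [2 |a|_oo > K], and [2 ^ (2 / n) <= 2]. *)
pose w : R := 2 / K%:R `^ (2 / n%:R).
have w0 : 0 <= w by rewrite divr_ge0 ?powR_ge0.
rewrite fsbig_finite//=.
apply: (@le_trans _ _ (\sum_(a <- fset_set (A `&` ~` B)) (gap_majorant R K r a * w)%:E)%E).
  rewrite big_seq [leRHS]big_seq; apply: lee_sum => a.
  rewrite in_fset_set// inE => -[[a0 g1 aK] aB].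
  have {}aK : (normoo a <= K)%N by rewrite -(ler_nat R).
  apply: (le_trans (max_relative_gap_majorant R n K r eps a _ r0 a0 g1 aK)); first by lia.
  rewrite lee_fin ler_wpM2l ?gap_majorant_ge0//.
  have aK2 : (K < 2 * normoo a)%N.
    suff : (K %/ 2 < normoo a)%N by lia.
    by rewrite ltnNge; apply/negP => aK2; apply: aB; split; rewrite ?ler_nat.
  have a1 : (0 < normoo a)%N by lia.
  have a1R : 1 <= (normoo a)%:R :> R by rewrite ler1n.
  have K0R : 0 < K%:R `^ (2 / n%:R) :> R by rewrite powR_gt0// ltr0n.
  rewrite /w -invf_div lef_pV2 ?posrE ?divr_gt0 ?powR_gt0 ?ltr0n//.
  apply: (@le_trans _ _ ((normoo a)%:R `^ (2 / n%:R))); last by rewrite ler_powR// ltW.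
  rewrite ler_pdivrMr//.
  apply: (@le_trans _ _ ((normoo a)%:R `^ (2 / n%:R) * 2 `^ (2 / n%:R))).
    rewrite -powRM// ge0_ler_powR ?nnegrE ?mulr_ge0//.
    by rewrite -natrM ler_nat mulnC ltnW.
  by rewrite ler_wpM2l ?powR_ge0// ler1_powR// ler1n.
rewrite sumEFin lee_fin -mulr_suml.
apply: (@le_trans _ _ ((C * K%:R `^ (2 / n%:R) * (2 * K)%:R ^+ n) * w)); last first.
  have K0R : 0 < K%:R `^ (2 / n%:R) :> R by rewrite powR_gt0// ltr0n.
  by rewrite le_eqVlt /w; apply/orP; left; apply/eqP; field; rewrite gt_eqF.
rewrite ler_wpM2r//; apply: le_trans avgK.
apply: (@le_trans _ _ (\sum_(a <- fset_set A) gap_majorant R K r a)).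
  apply: ler_sum_subset => // [a|a]; last exact: gap_majorant_ge0.
  by rewrite !in_fset_set// !inE => -[].
have := sum_Q_le R n K%:R (gap_majorant R K r) (ler0n _ _) (gap_majorant_ge0 R n K r).
by rewrite natrK.
Qed.

Theorem corollary2 (R : realType) (n : nat) (hn : (3 <= n)%N) :
  exists C : R, 0 < C /\
    forall (eps H : R), 2 / n%:R < eps -> 1 <= H ->
      (((N n H)%:R^-1)%:E * (\sum_(a \in Q n H) max_relative_gap eps a) <= C%:E)%E.
Proof.
have [C C0 sum_le] := sum_max_relative_gap_le R n hn.
(* The factor 2 is the inverse of the density in [N_ge]. *)
exists (2 * C); split; first by rewrite mulr_gt0.
move=> eps H eps_gt H1; set K := Num.truncn H.
have H0 : 0 <= H by exact: le_trans H1.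
have K0 : (0 < K)%N by rewrite truncn_gt0.
have -> : Q n H = Q n (K%:R : R).
  apply/seteqP; split=> a.
    by move=> /(Q_natP _ _ _ _ H0)[a0 g1 aK]; split; rewrite ?ler_nat.
  by move=> [a0 g1 aK]; apply/Q_natP => //; split; rewrite -?(ler_nat R).
have NK := N_ge R n H hn H1; rewrite -/K in NK.
have X0 : 0 < (2 * K)%:R ^+ n :> R by rewrite exprn_gt0// ltr0n muln_gt0.
have N0 : 0 < (N n H)%:R :> R by apply: lt_le_trans NK; rewrite divr_gt0.
apply: (le_trans (lee_wpmul2l _ (sum_le eps eps_gt K))); first by rewrite lee_fin invr_ge0 ltW.
rewrite -EFinM lee_fin mulrC ler_pdivrMr// mulrAC.
rewrite [X in _ <= X](_ : _ = C * (2 * (N n H)%:R)); last by ring.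
by rewrite ler_wpM2l ?(ltW C0)// mulrC -ler_pdivrMr.
Qed.
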